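(* Let $G$ be a graph on $n$ nodes where each node has a unique $b$-bit identifier with $b = O(\log n)$. There is a deterministic distributed algorithm that computes a network decomposition of $G$ with $O(\log n)$ colors and weak-diameter $O(\log^2 n)$, in $O(\log^5 n)$ rounds of the $\mathsf{CONGEST}$ model with $\Theta(\log n)$-bit messages. Moreover, for each cluster $\mathcal{C}$ of vertices in the output network decomposition, the algorithm provides a Steiner tree $T_{\mathcal{C}}$ with radius $O(\log^2 n)$ in $G$ whose set of terminal nodes is equal to $\mathcal{C}$, and each vertex of $G$ is in $O(\log n)$ Steiner trees of any given color out of the $O(\log n)$ color classes.
   Context: $\mathsf{CONGEST}$ model: the network is the graph $G$; there is a processor at each node; computation proceeds in synchronous rounds, and per round each node can send one message of the stated bit-size to each neighbor. Nodes initially know only their own identifier and neighbors (and $n$ up to a polynomial). The round complexity is the number of rounds until all nodes finish; each node must know its own part of the output (its cluster and color, and its part of the Steiner trees). A network decomposition with $C$ colors and weak-diameter $D$ is a partition of $V(G)$ into disjoint clusters, each cluster assigned one of $C$ colors, such that clusters joined by an edge of $G$ have different colors, and any two vertices of the same cluster are at distance at most $D$ in $G$ (distance measured in $G$, not in the cluster). A Steiner tree for a cluster $\mathcal{C}$ is a subtree of $G$ containing all vertices of $\mathcal{C}$ (its terminal nodes) and possibly other vertices (non-terminal nodes). *)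

(* Defs.v *)
From mathcomp Require Import all_boot.
Set Implicit Arguments. Unset Strict Implicit. Unset Printing Implicit Defensive.

(* lg n := floor(log2 n) + 1, a positive version of log n used in O(.) bounds *)
Definition lg (n : nat) : nat := (trunc_log 2 n).+1.

Definition msg := seq bool.

(* Local output of a node:
   - nd_cluster : label of its cluster (clusters = classes of equal labels)
   - nd_color   : color of its cluster
   - nd_trees   : its part of the Steiner trees: a list of pairs
       (cluster label L, parent) meaning the node belongs to the Steiner tree
       of cluster L, with parent = Some (identifier of its parent in that tree)
       or None if it is the root of that tree. *)
Record Output := mkOutput {
  nd_cluster : nat;
  nd_color : nat;
  nd_trees : seq (nat * option nat) }.

(* A deterministic synchronous message-passing algorithm (uniform: the same
   algorithm for every graph).  A node starts knowing the (polynomial) upper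
   bound N on n, its own identifier and the sorted list of identifiers of its
   neighbors.  In each round, a node in state s sends [al_send s u] to its
   neighbor with identifier u (None = no message); then it updates its state
   from the function mapping each neighbor identifier to the received message
   (None for non-neighbors / no message).  The algorithm runs [al_rounds N]
   rounds and every node then outputs [al_output] of its state. *)
Record Algorithm := mkAlgorithm {
  al_state : Type;
  al_init : nat -> nat -> seq nat -> al_state;
  al_send : al_state -> nat -> option msg;
  al_trans : al_state -> (nat -> option msg) -> al_state;
  al_rounds : nat -> nat;
  al_output : al_state -> Output }.

Section Exec.
Variables (A : Algorithm) (n : nat) (e : rel 'I_n) (ID : 'I_n -> nat) (N : nat).

Definition nbr_ids (v : 'I_n) : seq nat :=
  sort leq [seq ID u | u <- enum 'I_n & e v u].

Definition received (st : 'I_n -> al_state A) (v : 'I_n) : nat -> option msg :=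
  fun i => match [pick u | e v u && (ID u == i)] with
           | Some u => al_send (st u) (ID v)
           | None => None
           end.

Definition step_states (st : 'I_n -> al_state A) : 'I_n -> al_state A :=
  fun v => al_trans (st v) (received st v).

Definition state_at (t : nat) : 'I_n -> al_state A :=
  iter t step_states (fun v => @al_init A N (ID v) (nbr_ids v)).

Definition bandwidth_ok (B : nat) : Prop :=
  forall t, t < @al_rounds A N -> forall v u, e v u ->
    match al_send (state_at t v) (ID u) with
    | Some m => size m <= B
    | None => true
    end.

Definition final_output (v : 'I_n) : Output := @al_output A (state_at (@al_rounds A N) v).
End Exec.

Section Decomp.
Variables (n : nat) (e : rel 'I_n) (ID : 'I_n -> nat) (o : 'I_n -> Output).

Definition dist_le (u v : 'I_n) (d : nat) : Prop :=
  exists p : seq 'I_n, [/\ path e u p, last u p = v & size p <= d].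

Fixpoint lookup (s : seq (nat * option nat)) (L : nat) : option (option nat) :=
  match s with
  | [::] => None
  | (L', p) :: s' => if L' == L then Some p else lookup s' L
  end.

Definition in_tree (L : nat) (v : 'I_n) : bool := L \in map fst (nd_trees (o v)).

Definition is_cluster (L : nat) : Prop := exists w, nd_cluster (o w) = L.

Definition tparent (L : nat) (v : 'I_n) : option 'I_n :=
  match lookup (nd_trees (o v)) L with
  | Some (Some pid) => [pick u | e v u && (ID u == pid)]
  | _ => None
  end.

Fixpoint anc (L : nat) (k : nat) (v : 'I_n) : option 'I_n :=
  match k with
  | 0 => Some v
  | k'.+1 => obind (tparent L) (anc L k' v)
  end.

Definition network_decomposition (C D : nat) : Prop :=
  [/\ (forall v, nd_color (o v) < C),
      (forall u v, nd_cluster (o u) = nd_cluster (o v) ->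
        nd_color (o u) = nd_color (o v)),
      (forall u v, e u v -> nd_cluster (o u) <> nd_cluster (o v) ->
        nd_color (o u) <> nd_color (o v))
    & (forall u v, nd_cluster (o u) = nd_cluster (o v) -> dist_le u v D)].

(* For every cluster L, the nodes listing L form a Steiner tree T_L of G
   (parent pointers along edges of G, a unique root, every node reaches the
   root within R parent steps, so T_L is a subtree of G of radius <= R);
   its terminal set is exactly the cluster; trees are only given for clusters;
   and every node lies in at most K trees of clusters of any given color. *)
Definition steiner_trees (R K : nat) : Prop :=
  (forall v, uniq (map fst (nd_trees (o v)))) /\
  [/\ (forall v L, in_tree L v -> is_cluster L),
      (forall v, in_tree (nd_cluster (o v)) v),
      (forall v L pid, lookup (nd_trees (o v)) L = Some (Some pid) ->
        exists u, [/\ e v u, ID u = pid & in_tree L u]),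
      (forall L, is_cluster L ->
        exists r, lookup (nd_trees (o r)) L = Some None /\
          (forall v, in_tree L v -> exists k, k <= R /\ anc L k v = Some r))
    & (forall v col,
        count (fun L => [exists w, (nd_cluster (o w) == L) && (nd_color (o w) == col)])
              (map fst (nd_trees (o v))) <= K)].
End Decomp.

(* Main.v *)
(** The algorithm builds the color classes one after the other; each class
clusters at least half of the nodes not clustered so far, without two adjacent
clusters.

A cluster is named by the identifier L of its initial node, and it has a level
l.  Its key orders the pairs (l, bit l of L) lexicographically.  In every step,
each live node with a live neighbor of smaller key proposes to join a neighbor
of least key.  A cluster with t tokens accepts its p proposals and gains p
tokens if t <= 2 K p; otherwise it kills the proposing nodes, pays K tokens for
each of them, and is stalled, which means that no node adjacent to it has a
larger key until the phase of 2 K steps ends.  Stalled clusters then rise one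
level, and adjacent clusters keep agreeing on the first min(l, l') bits of
their names.

During a phase a cluster either doubles its tokens, or it rises one level and
loses at most half of them.  Only nodes that propose create tokens, and a
proposal decreases the key of a node, while the end of a phase increases it by
at most 3; so there are O(n log n) tokens, and after O(log n) phases all
clusters have as many levels as there are bits: adjacent clusters then coincide.
As K tokens are paid per killed node, at most half of the nodes are killed.

The tree of a cluster has one edge per proposal.  A node makes at most one
proposal per step, to a node that belongs to the tree since an earlier step.
Counting proposals in all trees simultaneously therefore takes one round per
past step, latest proposals first, with a single message per node and round;
broadcasting decisions proceeds in the opposite order.  This gives O(log^2 n)
rounds per step and O(log^5 n) rounds in total. *)

Require Import Defs.
From mathcomp Require Import all_boot zify.
Set Implicit Arguments. Unset Strict Implicit. Unset Printing Implicit Defensive.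

(** * The clustering process *)

Definition lkey (L l : nat) : nat := l.*2 + odd (L %/ 2 ^ l).

Lemma lkey_S L l : lkey L l.+1 <= lkey L l + 3.
Proof. rewrite /lkey; lia. Qed.

Lemma lkey_level L l L' l' : lkey L l <= lkey L' l' -> l <= l'.
Proof. rewrite /lkey; lia. Qed.

Lemma lkey_inj L l L' l' : lkey L l = lkey L' l' ->
  l = l' /\ odd (L %/ 2 ^ l) = odd (L' %/ 2 ^ l').
Proof.
rewrite /lkey => eq_k; have := congr1 half eq_k; have := congr1 odd eq_k.
by rewrite !oddD !odd_double !addFb !oddb ![_.*2 + _]addnC !half_bit_double.
Qed.

Lemma eqmod_pow2 L L' a b : b <= a -> L = L' %[mod 2 ^ a] -> L = L' %[mod 2 ^ b].
Proof.
move=> ba eqL; have d_ab := dvdn_exp2l 2 ba.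
by rewrite -(modn_dvdm L d_ab) eqL modn_dvdm.
Qed.

Lemma eqmod_pow2S L L' l : L = L' %[mod 2 ^ l] ->
  odd (L %/ 2 ^ l) = odd (L' %/ 2 ^ l) -> L = L' %[mod 2 ^ l.+1].
Proof.
have split_mod M : M %% 2 ^ l.+1 = odd (M %/ 2 ^ l) * 2 ^ l + M %% 2 ^ l.
  rewrite {1}(divn_eq M (2 ^ l)) -{1}(odd_double_half (M %/ 2 ^ l)) mulnDl -doubleMl.
  rewrite -mul2n mulnCA -expnS addnAC addnC modnMDl modn_small // expnS mul2n -addnn.
  by have := ltn_pmod M (expn_gt0 2 l : 0 < 2 ^ l); case: odd; lia.
by move=> eqM eqB; rewrite !split_mod eqM eqB.
Qed.

(** * The process without a network, on the set [S] of nodes still to be clustered *)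

Section Clustering.

Variables (n : nat) (e : rel 'I_n) (ID : 'I_n -> nat) (B K : nat) (S : pred 'I_n).
Hypothesis e_sym : symmetric e.
Hypothesis K_gt0 : 0 < K.
Local Notation T := K.*2.

Definition joins_t := nat -> 'I_n -> option ('I_n * 'I_n).

(* [joins t v = Some (r, u)] means that in step t node v proposed to the cluster
   of r through its neighbor u, whether or not the proposal was accepted: the
   nodes killed by a cluster stay in its tree as non-terminals. *)
Record clustering := Clustering {
  alive : 'I_n -> bool;
  clus : 'I_n -> 'I_n;
  tokens : 'I_n -> nat;
  level : 'I_n -> nat;
  stalled : 'I_n -> bool;
  joins : joins_t }.

Implicit Types (g : clustering) (p : 'I_n -> option ('I_n * 'I_n)) (u v w r : 'I_n).

Definition key g r := lkey (ID r) (level g r).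

(* The nodes of the tree of r after step t. *)
Definition memb (J : joins_t) r v t :=
  v = r \/ exists t' u, t' <= t /\ J t' v = Some (r, u).

Lemma memb_leq (J : joins_t) r v t t' : t <= t' -> memb J r v t -> memb J r v t'.
Proof.
by move=> tt' [->|[k [u [kt Jk]]]]; [left | right; exists k, u; rewrite (leq_trans kt)].
Qed.

(** Ties between neighbors of least key are left open, so any choice made by the network is
    covered. *)
Definition valid_props g p := forall v,
  match p v with
  | Some (r, u) => [/\ alive g v /\ alive g u, e v u, r = clus g u,
      key g r < key g (clus g v)
      & forall w, e v w -> alive g w -> key g r <= key g (clus g w)]
  | None => alive g v ->
      forall w, e v w -> alive g w -> key g (clus g v) <= key g (clus g w)
  end.

Definition nprops p r := \sum_v (omap fst (p v) == Some r).

(** A cluster that holds tokens and gets no proposal counts as refusing: it stalls at no cost. *)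
Definition accepts g p r := tokens g r <= nprops p r * T.

Definition resolve g (s : nat) p : clustering := Clustering
  (fun v => alive g v && (if p v is Some (r, _) then accepts g p r else true))
  (fun v => if p v is Some (r, _) then r else clus g v)
  (fun r => if accepts g p r then tokens g r + nprops p r
            else tokens g r - nprops p r * K)
  (level g)
  (fun r => stalled g r || ~~ accepts g p r)
  (fun t => if t == s then p else joins g t).

Definition raise g : clustering := Clustering (alive g) (clus g) (tokens g)
  (fun r => if stalled g r then minn B (level g r).+1 else level g r)
  (fun=> false) (joins g).

Definition njoins g s v := \sum_(1 <= t < s.+1) (joins g t v != None).

(** [s], [ph] and [j] count all steps, the completed phases and the steps of the current phase.
    [inv_njoins] is a potential argument: a proposal lowers the key of a node, and the end of a
    phase raises it by at most 3. [inv_tokens] is the account: one initial token per node, at most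
    one for each proposal, and [K] spent for each dead node. *)
Record run_inv g (s ph j : nat) : Prop := Inv {
  inv_joins : forall t v r u, joins g t v = Some (r, u) ->
    [/\ 0 < t <= s, S v, S r, e v u & memb (joins g) r u t.-1];
  inv_alive : forall v, alive g v ->
    [/\ S v, S (clus g v) & memb (joins g) (clus g v) v s];
  inv_level : forall r, level g r <= B;
  inv_agree : forall u v, alive g u -> alive g v -> e u v ->
    ID (clus g u) = ID (clus g v)
      %[mod 2 ^ minn (level g (clus g u)) (level g (clus g v))];
  inv_stalled : forall u v, alive g u -> alive g v -> e u v ->
    stalled g (clus g u) -> key g (clus g v) <= key g (clus g u);
  inv_njoins : forall v,
    njoins g s v + (if alive g v then key g (clus g v) else 0) <= 1 + 3 * ph;
  inv_tokens : \sum_(r | S r) tokens g r + K * \sum_(v | S v) ~~ alive g v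
    <= \sum_(v | S v) (1 + njoins g s v);
  (* While not stalled, a cluster gains in each step at least 1/T of the tokens
     that it had when the phase began; stalling costs at most half of them. *)
  inv_growth : forall r, S r -> level g r < B ->
    if stalled g r then 2 ^ ph <= 2 * tokens g r * 4 ^ level g r
    else (T + j) * 2 ^ ph <= T * tokens g r * 4 ^ level g r }.

Definition singletons : clustering :=
  Clustering S id (fun=> 1) (fun=> 0) (fun=> false) (fun _ _ => None).

Lemma inv_singletons : run_inv singletons 0 0 0.
Proof.
have nj v : njoins singletons 0 v = 0 by rewrite /njoins big_geq.
split=> //=.
- by move=> v Sv; split=> //; left.
- by move=> u v _ _ _; rewrite !minn0 !modn1.
- by move=> v; rewrite nj /key /lkey /=; case: (S v) => //; case: odd.
- have -> : \sum_(v | S v) ~~ S v = 0 by rewrite big1 // => v ->.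
  by rewrite muln0 addn0; apply: leq_sum => v _; rewrite leq_addr.
- by move=> r _ _; rewrite !muln1 addn0.
Qed.

(** * One step preserves the invariant *)

Section Resolve.

Variables (g : clustering) (s ph j : nat) (p : 'I_n -> option ('I_n * 'I_n)).
Hypotheses (g_inv : run_inv g s ph j) (p_ok : valid_props g p).
Let g' := resolve g s.+1 p.

(** A proposer has a larger key than its target, which [inv_stalled] excludes next to a stalled
    cluster. *)
Lemma nprops_stalled r : stalled g r -> nprops p r = 0.
Proof.
move=> r_st; apply: big1 => v _; apply/eqP; rewrite eqb0; apply/negP => /eqP.
have := p_ok v; case: (p v) => [[r' u]|] //= [[lv lu] vu -> lt_key _] [def_r].
have := inv_stalled g_inv lu lv; rewrite e_sym def_r => /(_ vu r_st).
by rewrite leqNgt -def_r lt_key.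
Qed.

Lemma key_resolve v : alive g v -> key g (clus g' v) <= key g (clus g v).
Proof.
move=> lv; rewrite /g' /=; have := p_ok v.
by case: (p v) => [[r u]|] // [_ _ _ /ltnW].
Qed.

Lemma alive_resolve v : alive g' v -> alive g v.
Proof. by case/andP. Qed.

Lemma memb_resolve r v t : t <= s -> memb (joins g) r v t -> memb (joins g') r v t.
Proof.
move=> ts [->|[k [u [kt Jk]]]]; [by left | right; exists k, u; split=> //=].
by rewrite ltn_eqF // ltnS (leq_trans kt).
Qed.

Lemma njoins_resolve v : njoins g' s.+1 v = njoins g s v + (p v != None).
Proof.
rewrite /njoins big_nat_recr //= eqxx; congr (_ + _).
by apply: eq_big_nat => t /andP[_ ts]; rewrite ltn_eqF.
Qed.

(** A node moves only to an adjacent cluster of at most its own level, so [inv_agree] compares the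
    old and the new cluster on as many bits as the new level. *)
Lemma agree_resolve v : alive g v ->
  level g (clus g' v) <= level g (clus g v) /\
  ID (clus g v) = ID (clus g' v) %[mod 2 ^ level g (clus g' v)].
Proof.
move=> lv; split; first exact: lkey_level (key_resolve lv).
have := lkey_level (key_resolve lv); rewrite /g' /=; have := p_ok v.
case: (p v) => [[r u]|] // [[_ lu] vu -> _ _] le_lev.
by have := inv_agree g_inv lv lu vu; rewrite (minn_idPr le_lev).
Qed.

Lemma inv_resolve : run_inv g' s.+1 ph j.+1.
Proof.
split.
- move=> t v r u /=; case: eqP => [-> pv|_ Jt].
    have := p_ok v; rewrite pv => -[[lv lu] vu -> _ _].
    have [Sv _ _] := inv_alive g_inv lv.
    have [Su Scu cu] := inv_alive g_inv lu.
    by split=> //; [rewrite ltnSn | apply: (memb_resolve (leqnn _))].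
  have [/andP[t0 ts] Sv Sr vu ru] := inv_joins g_inv Jt.
  split=> //; first by rewrite t0 leqW.
  by apply: memb_resolve ru; rewrite (leq_trans (leq_pred t)).
- move=> v lv'; have lv := alive_resolve lv'.
  have [Sv Scv cv] := inv_alive g_inv lv.
  have := p_ok v; rewrite /= ; case pv: (p v) => [[r u]|] /=.
    move=> [[_ lu] _ -> _ _]; have [_ Scu _] := inv_alive g_inv lu.
    split=> //; right; exists s.+1, u; rewrite eqxx pv; split=> //.
    by have := p_ok v; rewrite pv => -[_ _ ->].
  by split=> //; apply: memb_leq (memb_resolve (leqnn _) cv).
- exact: inv_level g_inv.
- move=> u v lu' lv' uv.
  have lu := alive_resolve lu'; have lv := alive_resolve lv'.
  have [le_u eq_u] := agree_resolve lu; have [le_v eq_v] := agree_resolve lv.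
  rewrite -(eqmod_pow2 (geq_minl _ _) eq_u) -(eqmod_pow2 (geq_minr _ _) eq_v).
  by apply: eqmod_pow2 (inv_agree g_inv lu lv uv); rewrite leq_min !geq_min le_u le_v orbT.
- move=> u v lu' lv' uv st_u.
  have lu := alive_resolve lu'; have lv := alive_resolve lv'.
  have st_ru := st_u; move: st_u; rewrite /= -/(clus g' u) => st_u.
  (* A cluster stalled before gets no proposals, and one that stalls now kills its proposers; so the
     live node [u] has kept its cluster. *)
  have pu : p u = None.
    case pu: (p u) => [[r w]|] //; move: st_u; rewrite pu /= => /orP[st_r|].
      have := nprops_stalled st_r; rewrite /nprops (bigD1 u) //= pu eqxx //.
    by have := lu'; rewrite /= pu lu /= => ->.
  have cu : clus g' u = clus g u by rewrite /= pu.
  change (key g (clus g' v) <= key g (clus g' u)); rewrite cu.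
  (* If the key of [v] was larger, then [v] has just proposed to a neighbor of least key, which is
     at most the key of [u]. *)
  have [le_uv|lt_uv] := leqP (key g (clus g v)) (key g (clus g u)).
    exact: leq_trans (key_resolve lv) le_uv.
  have := p_ok v; rewrite /=; case: (p v) => [[r w]|] /=; rewrite e_sym in uv.
    by move=> [_ _ _ _ /(_ u uv lu)].
  by move=> /(_ lv u uv lu).
- move=> v; rewrite njoins_resolve; have := inv_njoins g_inv v.
  rewrite /=; have := p_ok v; case: (p v) => [[r u]|] /=.
    move=> [[-> _] _ _ lt_key _] /= le_nj; case: ifP => _ ; first last.
      by rewrite addn0; move: le_nj lt_key; lia.
    by rewrite /key /= -/(key g r); move: le_nj lt_key; rewrite /key; lia.
  by rewrite andbT addn0.
(* Double counting: proposals grouped by target cluster or by proposing node. *)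
- have sumS F : \sum_(r | S r) nprops p r * F r =
      \sum_(v | S v) (if p v is Some (r, _) then F r else 0).
    transitivity (\sum_(r | S r) \sum_(v | S v) (omap fst (p v) == Some r) * F r).
      apply: eq_bigr => r _; rewrite /nprops big_distrl /= [RHS]big_mkcond /=.
      apply: eq_bigr => v _; case: ifP => // /negP nSv.
      have := p_ok v; case: (p v) => [[r' u]|] //= [[lv _] _ _ _ _].
      by have [/nSv] := inv_alive g_inv lv.
    rewrite exchange_big /=; apply: eq_bigr => v _.
    have := p_ok v; case: (p v) => [[r u]|] /= => [[[_ lu] _ def_r _ _]|_].
      have Sr : S r by have [_ Sr _] := inv_alive g_inv lu; rewrite def_r.
      rewrite (bigD1 r) //= eqxx mul1n big1 ?addn0 // => r' /andP[_ ne].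
      by case: eqP => // -[eq_r]; rewrite eq_r eqxx in ne.
    by rewrite big1.
  (* The truncated subtraction is exact: a cluster refusing [p] proposals has more than [2 K p]
     tokens. *)
  have tok r : tokens g' r + nprops p r * (K * ~~ accepts g p r)
               = tokens g r + nprops p r * accepts g p r.
    rewrite /=; case acc: (accepts g p r); rewrite /= ?muln0 ?muln1 ?addn0 //.
    move/negbT: acc; rewrite /accepts -ltnNge => lt_t; rewrite subnK //.
    by apply: leq_trans (ltnW lt_t); rewrite leq_mul2l -addnn leq_addr orbT.
  have dead v : S v -> ~~ alive g' v =
      ~~ alive g v + (if p v is Some (r, _) then nat_of_bool (~~ accepts g p r) else 0) :> nat.
    move=> Sv /=; have := p_ok v; case: (p v) => [[r u]|] /=.
      by case=> [[-> _]] _ _ _ _; case: accepts.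
    by rewrite andbT addn0.
  (* The tokens together with [K] per dead node are conserved, up to the tokens created by accepted
     proposals. *)
  have sum_tok : \sum_(r | S r) tokens g' r + K * \sum_(v | S v) ~~ alive g' v =
     (\sum_(r | S r) tokens g r + K * \sum_(v | S v) ~~ alive g v)
       + \sum_(r | S r) nprops p r * accepts g p r.
    rewrite (eq_bigr _ dead) big_split /= mulnDr addnA.
    have : \sum_(r | S r) (tokens g' r + nprops p r * (K * ~~ accepts g p r))
        = \sum_(r | S r) (tokens g r + nprops p r * accepts g p r).
      by apply: eq_bigr => r _; apply: tok.
    rewrite !big_split /= => tok_eq; rewrite [RHS]addnAC -tok_eq addnAC.
    congr (_ + _); congr (_ + _).
    rewrite -(sumS (fun r => nat_of_bool (~~ accepts g p r))) big_distrr /=.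
    by apply: eq_bigr => r _; rewrite mulnCA.
  rewrite sum_tok; apply: leq_trans (leq_add (inv_tokens g_inv) (leqnn _)) _.
  rewrite (sumS (fun r => nat_of_bool (accepts g p r))) -big_split /=.
  apply: leq_sum => v _; rewrite njoins_resolve -addnA !leq_add2l.
  by case: (p v) => [[r u]|] //=; case: accepts.
move=> r Sr lt_B; rewrite /= in lt_B *; have := inv_growth g_inv Sr lt_B.
case st_r: (stalled g r) => /=.
  by rewrite (nprops_stalled st_r) mul0n addn0 subn0; case: ifP.
(* Accepting adds at least a fraction 1/T of the current tokens, which by [yx] is worth one more
   unit of [j]. Refusing costs less than half of the tokens. *)
set x := 4 ^ _; set y := 2 ^ ph => gr; have yx : y <= tokens g r * x.
  have T_gt0 : 0 < T by rewrite double_gt0.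
  rewrite -(leq_pmul2l T_gt0) mulnA; apply: leq_trans gr.
  by rewrite leq_mul2r leq_addr orbT.
case acc: (accepts g p r); rewrite /= ?acc.
  rewrite addnS mulSn mulnDr [leqRHS]mulnDl addnC leq_add //; apply: leq_trans yx _.
  by rewrite leq_mul2r; apply/orP; right; rewrite mulnC; exact: acc.
apply: leq_trans yx _; rewrite leq_mul2r; apply/orP; right.
move/negbT: acc; rewrite /accepts -ltnNge -doubleMr; lia.
Qed.
End Resolve.

(** After [T] steps without stalling the factor [T + j] is [2 T], which doubles the bound; for a
    stalled cluster the factor 4 of the new level makes up for the loss of one half. *)
Lemma inv_raise g s ph : run_inv g s ph T -> run_inv (raise g) s ph.+1 0.
Proof.
move=> g_inv; split=> //=.
- exact: inv_joins g_inv.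
- exact: inv_alive g_inv.
- by move=> r; case: ifP => _; rewrite ?geq_minl ?(inv_level g_inv).
- move=> u v lu lv uv; have vu : e v u by rewrite e_sym.
  have eqm := inv_agree g_inv lu lv uv.
  have stu := inv_stalled g_inv lu lv uv; have stv := inv_stalled g_inv lv lu vu.
  (* If both are stalled, their keys are equal, and this supplies the next common bit. If one is,
     its level was already at least the other one, so the minimum does not grow. *)
  case st_u: (stalled g (clus g u)); case st_v: (stalled g (clus g v)) => //.
  + have eq_key : key g (clus g u) = key g (clus g v).
      by apply/eqP; rewrite eqn_leq stu // stv.
    have [eq_lev eq_bit] : level g (clus g u) = level g (clus g v) /\
        odd (ID (clus g u) %/ 2 ^ level g (clus g u)) =
        odd (ID (clus g v) %/ 2 ^ level g (clus g v)).
      exact: lkey_inj eq_key.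
    rewrite -eq_lev minnn in eqm *; rewrite -eq_lev in eq_bit.
    by apply: eqmod_pow2 (eqmod_pow2S eqm eq_bit); rewrite !geq_min leqnn orbT.
  + have := lkey_level (stu st_u) => le_l; apply: eqmod_pow2 eqm.
    by rewrite leq_min geq_minr (leq_trans (geq_minr _ _) le_l).
  + have := lkey_level (stv st_v) => le_l; apply: eqmod_pow2 eqm.
    by rewrite leq_min geq_minl (leq_trans (geq_minl _ _) le_l).
- move=> v; have := inv_njoins g_inv v; rewrite mulnS addnCA.
  rewrite -/(njoins g s v); case: ifP => lv; last by rewrite /njoins /=; lia.
  suff : key (raise g) (clus g v) <= key g (clus g v) + 3 by rewrite /njoins /=; lia.
  rewrite /key /=; case: ifP => _; last by rewrite leq_addr.
  have := inv_level g_inv (clus g v); rewrite leq_eqVlt => /predU1P[->|lt_B].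
    by rewrite (minn_idPl (leqnSn B)) leq_addr.
  by rewrite (minn_idPr lt_B) lkey_S.
- exact: inv_tokens g_inv.
move=> r Sr; rewrite addn0; have := inv_growth g_inv Sr.
case: ifP => st_r; last by rewrite expnS -addnn; lia.
move=> gr lt_B; have {lt_B} [lt_B ->] : level g r < B /\ minn B (level g r).+1 = (level g r).+1.
  by move: lt_B; lia.
have y_le := gr lt_B; rewrite !expnS -mulnA leq_mul2l; apply/orP; right.
by move: y_le; set x := 4 ^ _; set y := 2 ^ ph; lia.
Qed.

Lemma inv_step g s p : run_inv g s (s %/ T) (s %% T) -> valid_props g p ->
  let g' := resolve g s.+1 p in
  run_inv (if T %| s.+1 then raise g' else g') s.+1 (s.+1 %/ T) (s.+1 %% T).
Proof.
move=> g_inv p_ok; have T_gt0 : 0 < T by rewrite double_gt0.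
have := inv_resolve g_inv p_ok; rewrite divnS // modnS; case: ifP => //= dvd_T.
suff -> : (s %% T).+1 = T by move/inv_raise.
apply/eqP; rewrite eqn_leq ltn_mod T_gt0 /= dvdn_leq //.
by move: dvd_T; rewrite {1}(divn_eq s T) -addnS dvdn_addr // dvdn_mull.
Qed.

(** * After the last phase: all levels are maximal and at most half of the nodes are dead *)

Section Finish.

Variables (g : clustering) (s ph : nat).
Hypothesis g_inv : run_inv g s ph 0.
Hypothesis ID_inj : injective ID.
Hypothesis ID_lt : forall v, ID v < 2 ^ B.
Hypothesis ph_ge : 2 * B <= ph.
Hypothesis ph_big : n * (3 * ph + 2) < 2 ^ (ph - 2 * B).

Lemma njoins_le v : 1 + njoins g s v <= 3 * ph + 2.
Proof.
by have := leq_trans (leq_addr _ _) (inv_njoins g_inv v); rewrite -/(njoins g s v); clear; lia.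
Qed.

Lemma sum_njoins_le : \sum_(v | S v) (1 + njoins g s v) <= (\sum_v S v) * (3 * ph + 2).
Proof.
rewrite [\sum_v S v]big_mkcond big_distrl /= [leqLHS]big_mkcond; apply: leq_sum => v _.
by rewrite -mulnbl; case: (S v); rewrite ?mul1n ?njoins_le.
Qed.

(** A cluster below level [B] would own at least [2 ^ (ph - 2 B)] tokens by the growth invariant,
    but at most [n (3 ph + 2)] tokens are ever created. *)
Lemma level_final r : S r -> level g r = B.
Proof.
move=> Sr; apply/eqP; rewrite eqn_leq (inv_level g_inv) leqNgt; apply/negP => lt_B.
have tok_le : tokens g r <= n * (3 * ph + 2).
  apply: leq_trans (_ : (\sum_v S v) * (3 * ph + 2) <= _); last first.
    rewrite leq_mul2r; apply/orP; right; rewrite -[leqRHS]card_ord -sum1_card.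
    by apply: leq_sum => v _; case: (S v).
  apply: leq_trans sum_njoins_le; apply: leq_trans (inv_tokens g_inv).
  by rewrite (bigD1 r) //= -addnA leq_addr.
have {}tok_le : tokens g r * 4 ^ B < 2 ^ ph.
  rewrite -(subnK ph_ge) expnD expnM ltn_pmul2r ?expn_gt0 //.
  exact: leq_ltn_trans tok_le ph_big.
have le_4 : 4 * 4 ^ level g r <= 4 ^ B by rewrite -expnS leq_exp2l.
have := inv_growth g_inv Sr lt_B; case: ifP => _; rewrite leqNgt => /negP; case.
  apply: leq_ltn_trans tok_le; rewrite mulnAC mulnC leq_mul2l.
  by apply/orP; right; apply: leq_trans le_4; rewrite leq_mul2r orbT.
rewrite addn0 -mulnA ltn_pmul2l ?double_gt0 //; apply: leq_ltn_trans tok_le.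
by rewrite leq_mul2l leq_exp2l // (ltnW lt_B) orbT.
Qed.

(** At level [B] agreement of names modulo [2 ^ B] is equality. *)
Lemma clus_final u v : alive g u -> alive g v -> e u v -> clus g u = clus g v.
Proof.
move=> lu lv uv; apply: ID_inj; have := inv_agree g_inv lu lv uv.
have [_ Su _] := inv_alive g_inv lu; have [_ Sv _] := inv_alive g_inv lv.
by rewrite !level_final // minnn !modn_small.
Qed.

(** Each node of [S] accounts for at most [3 ph + 2] tokens, and a killed node costs twice that
    amount. *)
Lemma dead_final : K = 2 * (3 * ph + 2) ->
  2 * \sum_v (S v && ~~ alive g v) <= \sum_v S v.
Proof.
move=> def_K; have pos : 0 < 3 * ph + 2 by rewrite addn2.
rewrite -(leq_pmul2r pos) mulnAC -def_K; apply: leq_trans sum_njoins_le.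
apply: leq_trans (inv_tokens g_inv); apply: leq_trans (leq_addl _ _).
rewrite leq_mul2l [leqRHS]big_mkcond; apply/orP; right; apply: leq_sum => v _.
by case: (S v).
Qed.

End Finish.

End Clustering.

(** * Round programs as CONGEST algorithms *)

Fixpoint enc (w a : nat) : seq bool :=
  if w is w'.+1 then odd a :: enc w' a./2 else [::].

Fixpoint dec_bits (m : seq bool) : nat :=
  if m is c :: m' then c + (dec_bits m').*2 else 0.

Lemma size_enc w a : size (enc w a) = w.
Proof. by elim: w a => //= w IHw a; rewrite IHw. Qed.

Lemma encK w a : a < 2 ^ w -> dec_bits (enc w a) = a.
Proof.
elim: w a => [|w IHw] a /=; first by rewrite expn0 ltnS leqn0 => /eqP.
by rewrite expnS => lt_a; rewrite IHw ?odd_double_half //; lia.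
Qed.

Definition enc2 w (m : nat * nat) := enc w m.1 ++ enc w m.2.
Definition dec2 w (m : seq bool) := (dec_bits (take w m), dec_bits (drop w m)).

Lemma enc2K w m : m.1 < 2 ^ w -> m.2 < 2 ^ w -> dec2 w (enc2 w m) = m.
Proof.
case: m => a b /= lt_a lt_b; rewrite /dec2 /enc2 take_size_cat ?size_enc //.
by rewrite drop_size_cat ?size_enc // !encK.
Qed.

Record round (X : Type) := Round {
  rsend : X -> nat -> option (nat * nat);
  rtrans : X -> (nat -> option (nat * nat)) -> X }.

Section Programs.

Variables (X : Type) (w : nat -> nat) (rounds : nat -> seq (round X))
  (init : nat -> nat -> seq nat -> X) (output : X -> Output).

(* The state carries the rounds that remain to be executed. *)
Record pstate := PState { width : nat; todo : seq (round X); memory : X }.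

Definition program_algorithm : Algorithm := {|
  al_state := pstate;
  al_init := fun N i nb => PState (w N) (rounds N) (init N i nb);
  al_send := fun x i =>
    if todo x is r :: _ then omap (enc2 (width x)) (rsend r (memory x) i) else None;
  al_trans := fun x f =>
    if todo x is r :: rs
    then PState (width x) rs (rtrans r (memory x) (fun i => omap (dec2 (width x)) (f i)))
    else x;
  al_rounds := fun N => size (rounds N);
  al_output := fun x => output (memory x) |}.

Variables (n : nat) (e : rel 'I_n) (ID : 'I_n -> nat).

(** Encoding and decoding are kept in the semantics: a component that does not fit into [w0] bits
    arrives truncated. *)
Definition deliver w0 (r : round X) (st : 'I_n -> X) (v : 'I_n) (i : nat) :=
  omap (dec2 w0) (if [pick u | e v u && (ID u == i)] is Some u
                  then omap (enc2 w0) (rsend r (st u) (ID v)) else None).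

Definition net_step w0 r st v := rtrans r (st v) (deliver w0 r st v).

Definition net_run w0 (rs : seq (round X)) st := foldl (fun st r => net_step w0 r st) st rs.

Lemma net_run_cons w0 r rs st : net_run w0 (r :: rs) st = net_run w0 rs (net_step w0 r st).
Proof. by []. Qed.

Lemma net_run_cat w0 rs rs' st : net_run w0 (rs ++ rs') st = net_run w0 rs' (net_run w0 rs st).
Proof. exact: foldl_cat. Qed.

Lemma deliverE w0 r st v u : injective ID -> e v u ->
  deliver w0 r st v (ID u) = omap (dec2 w0) (omap (enc2 w0) (rsend r (st u) (ID v))).
Proof.
move=> ID_inj vu; rewrite /deliver; case: pickP => [u' /andP[_ /eqP /ID_inj ->] //|].
by move/(_ u); rewrite vu eqxx.
Qed.

Lemma state_at_program N t :
  state_at program_algorithm e ID N t = fun v =>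
    PState (w N) (drop t (rounds N))
      (net_run (w N) (take t (rounds N)) (fun v => init N (ID v) (nbr_ids e ID v)) v).
Proof.
rewrite /state_at /=; set x := fun v => init N _ _.
change (fun v => PState (w N) (rounds N) _) with (fun v => PState (w N) (rounds N) (x v)).
(* The induction executes the first round first, so it needs an arbitrary list of rounds and an
   arbitrary memory; an exhausted program leaves the state fixed. *)
elim: t (rounds N) x => [|t IHt] rs x; first by rewrite drop0 take0.
rewrite iterSr; case: rs => [|r rs] /=; last exact: (IHt rs (net_step (w N) r x)).
exact: (IHt [::] x).
Qed.

(** [enc] writes exactly [w N] bits for either component, whatever its value. *)
Lemma program_bandwidth N : bandwidth_ok program_algorithm e ID N (2 * w N).
Proof.
move=> t _ v u _; rewrite state_at_program /=; case: (drop t _) => [|r rs] //=.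
by case: (rsend r _ _) => //= m; rewrite size_cat !size_enc mul2n addnn.
Qed.

Lemma program_output N :
  final_output program_algorithm e ID N = fun v =>
  output (net_run (w N) (rounds N) (fun v => init N (ID v) (nbr_ids e ID v)) v).
Proof. by rewrite /final_output state_at_program /= take_size. Qed.

End Programs.

Lemma sum_nbr_ids n (e : rel 'I_n) ID v (F : nat -> nat) :
  \sum_(i <- nbr_ids e ID v) F i = \sum_(u | e v u) F (ID u).
Proof.
rewrite /nbr_ids (perm_big _ (permEl (perm_sort _ _))) big_map big_filter.
by rewrite big_enum_cond.
Qed.

Lemma mem_nbr_ids n (e : rel 'I_n) ID v i :
  reflect (exists2 u, e v u & i = ID u) (i \in nbr_ids e ID v).
Proof.
rewrite /nbr_ids mem_sort; apply: (iffP mapP) => -[u].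
  by rewrite mem_filter => /andP[vu _] ->; exists u.
by move=> vu ->; exists u; rewrite // mem_filter vu mem_enum.
Qed.

(** * One step of the process as a round program *)

(** The data that survive from one color class to the next; [act] marks the nodes not clustered so
    far. *)
Record node := Node { me : nat; nbs : seq nat; act : bool; out : Output }.

Record member := Member {
  liv : bool; lab : nat; lev : nat; log : nat -> option (nat * nat) }.

(** The role of a node as center of the cluster bearing its name, which it keeps even after leaving
    that cluster or dying. *)
Record root := Root { tok : nat; stl : bool; rlev : nat }.

(** A node relays for many trees, so [cnt] and [dec] are indexed by cluster name; [rq] holds the
    requests to be answered. *)
Record lstate := LState {
  nd : node; mb : member; rt : root;
  cnt : nat -> nat; dec : nat -> nat * nat; rq : nat -> option (nat * nat) }.

(** The part of the state that communication along the trees leaves unchanged. *)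
Definition core x := (nd x, mb x, rt x).
Definition no_msg (x : lstate) (i : nat) : option (nat * nat) := None.

Section Rounds.

Variables (B K : nat).
Local Notation T := K.*2.

Definition start_round : round lstate := Round no_msg (fun x _ =>
  LState (nd x) (Member (act (nd x)) (me (nd x)) 0 (fun=> None)) (Root 1 false 0)
    (fun=> 0) (fun=> (0, 0)) (fun=> None)).

Definition mkey (m : option (nat * nat)) := omap (fun m => lkey m.1 m.2) m.

Definition best_offer (nb : seq nat) (k0 : nat) (f : nat -> option (nat * nat)) :=
  let k := find (fun k => has (fun i => mkey (f i) == Some k) nb) (iota 0 k0) in
  if k < k0 then
    let i := nth 0 nb (find (fun i => mkey (f i) == Some k) nb) in
    omap (fun m => (m.1, i)) (f i)
  else None.

Definition propose_round s : round lstate := Round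
  (fun x _ => if liv (mb x) then Some (lab (mb x), lev (mb x)) else None)
  (fun x f =>
    let m := mb x in
    let p := if liv m then best_offer (nbs (nd x)) (lkey (lab m) (lev m)) f else None in
    LState (nd x) (Member (liv m) (lab m) (lev m) (fun t => if t == s then p else log m t))
      (rt x) (fun L => omap fst p == Some L) (dec x) (rq x)).

(* Nodes that joined in step t move their partial counts to their parents, which
   joined earlier: no count is lost, and after round 1 only roots have counts. *)
Definition up_round t : round lstate := Round
  (fun x i => if log (mb x) t is Some (L, i') then
                if i' == i then Some (L, cnt x L) else None else None)
  (fun x f =>
    LState (nd x) (mb x) (rt x)
      (fun L => (if omap fst (log (mb x) t) == Some L then 0 else cnt x L)
        + \sum_(i <- nbs (nd x)) (if f i is Some (L', y) then (L' == L) * y else 0))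
      (dec x) (rq x)).

(** [dec] is set for all names at once: only the entry for the own name is meaningful here, and the
    entries for other trees are overwritten by replies before they are used. *)
Definition decide_round last : round lstate := Round no_msg (fun x _ =>
  let p := cnt x (me (nd x)) in let r := rt x in
  let acc := tok r <= p * T in
  let st := stl r || ~~ acc in
  let l := if last then if st then minn B (rlev r).+1 else rlev r else rlev r in
  LState (nd x) (mb x)
    (Root (if acc then tok r + p else tok r - p * K) (if last then false else st) l)
    (cnt x) (fun=> (nat_of_bool acc, l)) (rq x)).

(** Parents keep no list of children, so a child has to ask before it gets the decision. *)
Definition request_round t : round lstate := Round
  (fun x i => if log (mb x) t is Some (L, i') then
                if i' == i then Some (L, 0) else None else None)
  (fun x f => LState (nd x) (mb x) (rt x) (cnt x) (dec x) f).

Definition reply_round t : round lstate := Round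
  (fun x i => omap (fun m => dec x m.1) (rq x i))
  (fun x f =>
    if log (mb x) t is Some (L, i) then
      if f i is Some d then
        LState (nd x) (mb x) (rt x) (cnt x) (fun L' => if L' == L then d else dec x L') (rq x)
      else x
    else x).

Definition settle_round s : round lstate := Round no_msg (fun x _ =>
  let m := mb x in
  LState (nd x)
    (if log m s is Some (L, _)
     then Member (liv m && ((dec x L).1 == 1)) L (dec x L).2 (log m)
     else Member (liv m) (lab m) (dec x (lab m)).2 (log m))
    (rt x) (cnt x) (dec x) (rq x)).

Fixpoint ups s := if s is s'.+1 then up_round s :: ups s' else [::].

Fixpoint downs s :=
  if s is s'.+1 then downs s' ++ [:: request_round s; reply_round s] else [::].

Definition step_rounds s last :=
  propose_round s :: ups s ++ decide_round last :: downs s ++ [:: settle_round s].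

End Rounds.

Lemma best_offer_spec nb k0 f :
  match best_offer nb k0 f with
  | Some (L, i) => exists l, [/\ i \in nb, f i = Some (L, l), lkey L l < k0
      & forall i' L' l', i' \in nb -> f i' = Some (L', l') -> lkey L l <= lkey L' l']
  | None => forall i L l, i \in nb -> f i = Some (L, l) -> k0 <= lkey L l
  end.
Proof.
rewrite /best_offer; set P := fun k => has _ nb; set k := find P _.
have min_k i L l : i \in nb -> f i = Some (L, l) -> lkey L l < k0 -> k <= lkey L l.
  move=> nb_i fi lt_k0; rewrite leqNgt; apply/negP => /(before_find 0).
  rewrite nth_iota // add0n => /negP; case; apply/hasP; exists i => //.
  by rewrite fi.
case: ltnP => [lt_k|ge_k]; last first.
  move=> i L l nb_i fi; rewrite leqNgt; apply/negP => lt_k.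
  by have := min_k _ _ _ nb_i fi lt_k; rewrite leqNgt (leq_trans lt_k ge_k).
have has_k : has P (iota 0 k0) by rewrite has_find size_iota.
have Pk : P k by have := nth_find 0 has_k; rewrite nth_iota // add0n.
set i := nth 0 nb _; have nb_i : i \in nb by rewrite mem_nth // -has_find.
have := nth_find 0 Pk; rewrite -/i; case fi: (f i) => [[L l]|] //= /eqP[def_k].
exists l; split; rewrite ?def_k // => i' L' l' nb_i' fi'.
by case: (ltnP (lkey L' l') k0) => [/(min_k _ _ _ nb_i' fi') //|]; apply/leq_trans/ltnW.
Qed.

Section Network.

Variables (n : nat) (e : rel 'I_n) (ID : 'I_n -> nat) (w : nat).
Hypothesis e_sym : symmetric e.
Hypothesis ID_inj : injective ID.
Hypothesis ID_lt : forall v, ID v < 2 ^ w.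
Hypothesis n_lt : n < 2 ^ w.
Local Notation nstep := (@net_step lstate n e ID w).
Local Notation nrun := (@net_run lstate n e ID w).
Local Notation ndeliver := (@deliver lstate n e ID w).

Definition idp (q : 'I_n * 'I_n) := (ID q.1, ID q.2).

Definition local_net (st : 'I_n -> lstate) := forall v,
  me (nd (st v)) = ID v /\ nbs (nd (st v)) = nbr_ids e ID v.

Definition logs (J : joins_t n) (st : 'I_n -> lstate) := forall v t,
  log (mb (st v)) t = omap idp (J t v).

Definition join_tree (J : joins_t n) := forall t v r u, J t v = Some (r, u) ->
  [/\ 0 < t, e v u & memb J r u t.-1].

Lemma deliver_adj r st v u m : e v u -> rsend r (st u) (ID v) = Some m ->
  m.1 < 2 ^ w -> m.2 < 2 ^ w -> ndeliver r st v (ID u) = Some m.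
Proof. by move=> vu def_m lt1 lt2; rewrite deliverE // def_m /= enc2K. Qed.

Lemma deliver_none r st v u : e v u -> rsend r (st u) (ID v) = None ->
  ndeliver r st v (ID u) = None.
Proof. by move=> vu def_m; rewrite deliverE // def_m. Qed.

(** * Counting and broadcasting along all trees at once *)

Section Convergecast.

Variables (J : joins_t n).
Hypothesis J_tree : join_tree J.

Lemma up_cnt t st v r : local_net st -> logs J st ->
  (forall u, cnt (st u) (ID r) < 2 ^ w) ->
  cnt (nstep (up_round t) st v) (ID r) =
    (if omap fst (J t v) == Some r then 0 else cnt (st v) (ID r))
    + \sum_u (J t u == Some (r, v)) * cnt (st u) (ID r).
Proof.
move=> st_net st_log small; rewrite /= st_log (proj2 (st_net v)) sum_nbr_ids.
congr (_ + _).
  case: (J t v) => [[r' u]|] //=.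
  congr (if _ then _ else _); apply/eqP/eqP => [[/ID_inj ->]|[->]] //.
rewrite big_mkcond; apply: eq_bigr => u _; case: ifP => vu; last first.
  case: eqP => // Ju; have [_ uv _] := J_tree Ju.
  by rewrite e_sym uv in vu.
case Ju: (J t u) => [[r' v']|]; last by rewrite deliver_none //= st_log Ju.
have [eq_v|ne_v] := eqVneq v' v; last first.
  rewrite deliver_none //= ?st_log ?Ju /= ?(inj_eq ID_inj) ?(negPf ne_v) //.
  by case: eqP => // -[_ eq_v]; rewrite eq_v eqxx in ne_v.
have [eq_r|ne_r] := eqVneq r' r.
  rewrite eq_r eq_v (deliver_adj (m := (ID r, cnt (st u) (ID r)))) //= ?eqxx //.
  by rewrite st_log Ju /= eq_v eqxx eq_r.
(* A count for another tree has no bound here and may arrive truncated; only its label is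
   decoded. *)
case def_m: ndeliver => [[L y]|] //.
  move: def_m; rewrite deliverE //= st_log Ju /= eq_v eqxx /= => -[] .
  rewrite /dec2 /enc2 take_size_cat ?size_enc //= encK // => <- _.
  rewrite (inj_eq ID_inj) (negPf ne_r) !mul0n.
  by case: eqP => // -[eq_r]; rewrite eq_r eqxx in ne_r.
by case: eqP => // -[eq_r]; rewrite eq_r eqxx in ne_r.
Qed.

(** Round [t] moves the counts away from the nodes that joined in step [t], to nodes that were
    members earlier; in the end only the root holds a count. Sums are preserved, and the bound on
    the total makes every partial count fit into a message. *)
Lemma ups_run s st : local_net st -> logs J st ->
  (forall v r, 0 < cnt (st v) (ID r) -> memb J r v s) ->
  (forall r, \sum_v cnt (st v) (ID r) < 2 ^ w) ->
  (forall v, core (nrun (ups s) st v) = core (st v)) /\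
  forall r, cnt (nrun (ups s) st r) (ID r) = \sum_v cnt (st v) (ID r).
Proof.
elim: s st => [|s IHs] st st_net st_log loc small /=.
  split=> // r; rewrite (bigD1 r) //= big1 ?addn0 // => v ne_vr.
  apply/eqP; rewrite -leqn0 leqNgt; apply/negP => /loc[eq_v|[t [u [t0]]]].
    by rewrite eq_v eqxx in ne_vr.
  by move=> /J_tree[]; rewrite ltnNge t0.
set st1 := nstep _ st.
have small1 r u : cnt (st u) (ID r) < 2 ^ w.
  by apply: leq_ltn_trans (small r); rewrite (bigD1 u) //= leq_addr.
have cnt1 v r := up_cnt s.+1 v st_net st_log (small1 r).
(* Each node either keeps its count or hands it to exactly one parent. *)
have sum1 r : \sum_v cnt (st1 v) (ID r) = \sum_v cnt (st v) (ID r).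
  rewrite (eq_bigr _ (fun v _ => cnt1 v r)) big_split exchange_big -big_split /=.
  apply: eq_bigr => u _; case Ju: (J s.+1 u) => [[r' v]|]; last first.
    by rewrite /= big1 ?addn0.
  have [eq_r|ne_r] := eqVneq r' r; last first.
    rewrite /= big1 => [|v' _]; last by case: eqP => // -[eq_r]; rewrite eq_r eqxx in ne_r.
    by case: eqP => [[eq_r]|]; rewrite ?addn0 //; rewrite eq_r eqxx in ne_r.
  rewrite eq_r eqxx add0n (bigD1 v) //= eqxx mul1n big1 ?addn0 // => v' ne_v.
  by case: eqP => // -[eq_v]; rewrite eq_v eqxx in ne_v.
have [||||core1 cnt2] := IHs st1.
- by [].
- by [].
- move=> v r; rewrite /st1 cnt1 addn_gt0 => /orP[].
    case: ifP => // ne_r /loc[->|[t [u [le_t Jt]]]]; first by left.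
    right; exists t, u; split=> //; rewrite -ltnS ltn_neqAle le_t andbT.
    by apply: contraFneq ne_r => eq_t; rewrite -eq_t Jt.
  rewrite lt0n sum_nat_eq0 => /forallPn[u]; rewrite negb_imply /= => /eqP.
  by case: eqP => // /J_tree[_ _].
- by move=> r; rewrite sum1.
by split=> [v|r]; rewrite ?core1 ?cnt2 ?sum1.
Qed.

(** Induction forward in time: the parent of a node that joins in step [s.+1] is a member since step
    [s] at the latest, so it knows the decision when asked. *)
Lemma downs_run (S : pred 'I_n) (D : 'I_n -> nat * nat) s st : logs J st ->
  (forall t v r u, J t v = Some (r, u) -> S r) ->
  (forall r, S r -> [/\ dec (st r) (ID r) = D r, (D r).1 < 2 ^ w & (D r).2 < 2 ^ w]) ->
  (forall v, core (nrun (downs s) st v) = core (st v)) /\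
  forall v r, S r -> memb J r v s -> dec (nrun (downs s) st v) (ID r) = D r.
Proof.
move=> st_log J_S D_ok; elim: s => [|s [core0 dec0]] /=.
  split=> // v r Sr [->|[t [u [t0 /J_tree[]]]]]; first by case: (D_ok r Sr).
  by rewrite ltnNge t0.
rewrite net_run_cat; set st0 := net_run _ _ _ _ st in core0 dec0 *.
have log0 : logs J st0 by move=> v t; rewrite -st_log; case: (core0 v) => _ ->.
set st1 := nstep (request_round s.+1) st0; set st2 := nstep (reply_round s.+1) st1.
change (net_run _ _ _ _ st0) with st2.
have st2E v : st2 v = if J s.+1 v is Some (r, u)
    then LState (nd (st0 v)) (mb (st0 v)) (rt (st0 v)) (cnt (st0 v))
           (fun L => if L == ID r then D r else dec (st0 v) L) (rq (st1 v))
    else st1 v.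
  rewrite /st2 /st1 /nstep /= log0; case Jv: (J s.+1 v) => [[r u]|] //=.
  have [_ vu ru] := J_tree Jv; have Sr := J_S _ _ _ _ Jv.
  have [_ lt1 lt2] := D_ok r Sr; rewrite (deliver_adj (m := D r)) //=.
  rewrite (deliver_adj (m := (ID r, 0))) /= ?dec0 // ?expn_gt0 //; first by rewrite e_sym.
  by rewrite log0 Jv /= eqxx.
split=> [v|v r Sr rv]; first by rewrite st2E -core0; case: (J _ v) => [[r u]|].
rewrite st2E; case Jv: (J s.+1 v) => [[r' u']|] /=.
  rewrite (inj_eq ID_inj); case: eqP => [->|ne_r] //; rewrite dec0 //.
  case: rv => [->|[t [u [le_t Jt]]]]; first by left.
  right; exists t, u; split=> //; rewrite -ltnS ltn_neqAle le_t andbT.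
  by apply/eqP => eq_t; case: ne_r; move: Jt; rewrite eq_t Jv => -[->].
rewrite dec0 //; case: rv => [->|[t [u [le_t Jt]]]]; first by left.
right; exists t, u; split=> //; rewrite -ltnS ltn_neqAle le_t andbT.
by apply/eqP => eq_t; rewrite eq_t Jv in Jt.
Qed.

End Convergecast.

Section Step.

Variables (B K s : nat) (b0 : 'I_n -> node) (g : clustering n).
Hypothesis K_gt0 : 0 < K.
Hypothesis B_lt : B < 2 ^ w.
Hypothesis b0_net : forall v, me (b0 v) = ID v /\ nbs (b0 v) = nbr_ids e ID v.
Let S : pred 'I_n := fun v => act (b0 v).

(** Labels and levels are tied to the process only at live nodes, the root data at every node. *)
Definition simulates (st : 'I_n -> lstate) g := forall v,
  [/\ nd (st v) = b0 v, rt (st v) = Root (tokens g v) (stalled g v) (level g v),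
      liv (mb (st v)) = alive g v,
      (forall t, log (mb (st v)) t = omap idp (joins g t v))
    & alive g v ->
      lab (mb (st v)) = ID (clus g v) /\ lev (mb (st v)) = level g (clus g v)].

Lemma propose_run st ph j : run_inv e ID B K S g s ph j -> simulates st g ->
  exists2 p, valid_props e ID g p & forall v,
    let st1 := nstep (propose_round s.+1) st in
    [/\ nd (st1 v) = b0 v, rt (st1 v) = rt (st v),
        mb (st1 v) = Member (liv (mb (st v))) (lab (mb (st v))) (lev (mb (st v)))
          (fun t => if t == s.+1 then omap idp (p v) else log (mb (st v)) t)
      & forall r, cnt (st1 v) (ID r) = (omap fst (p v) == Some r)].
Proof.
move=> g_inv sim.
have exchange u v : e v u -> ndeliver (propose_round s.+1) st v (ID u) =
    if alive g u then Some (ID (clus g u), level g (clus g u)) else None.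
  move=> vu; have [_ _ liv_u _ lab_u] := sim u; case: ifP => lu.
    rewrite (deliver_adj (m := (ID (clus g u), level g (clus g u)))) //=.
      by rewrite liv_u lu; case: (lab_u lu) => -> ->.
    exact: leq_ltn_trans (inv_level g_inv _) B_lt.
  by rewrite deliver_none //= liv_u lu.
pose q v := if alive g v then best_offer (nbr_ids e ID v) (key ID g (clus g v))
  (ndeliver (propose_round s.+1) st v) else None.
pose valid v (o : option ('I_n * 'I_n)) := match o with
  | Some (r, u) => [/\ alive g v /\ alive g u, e v u, r = clus g u,
      key ID g r < key ID g (clus g v)
      & forall w, e v w -> alive g w -> key ID g r <= key ID g (clus g w)]
  | None => alive g v ->
      forall w, e v w -> alive g w -> key ID g (clus g v) <= key ID g (clus g w)
  end.
(* The network computes identifiers; here vertices carrying them are chosen for all nodes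
   simultaneously. *)
have [p p_ok] : exists p : 'I_n -> option ('I_n * 'I_n), forall v,
    q v = omap idp (p v) /\ valid v (p v).
  apply: (fin_all_exists (P := fun v o => q v = omap idp o /\ valid v o)) => v.
  rewrite /q; case: ifP => lv; last by exists None; split; rewrite // /valid lv.
  have := best_offer_spec (nbr_ids e ID v) (key ID g (clus g v))
    (ndeliver (propose_round s.+1) st v).
  case: best_offer => [[L i] [l [/mem_nbr_ids[u vu ->]]]|none]; last first.
    exists None; split=> // _ u vu lu; apply: (none (ID u)); first by apply/mem_nbr_ids; exists u.
    by rewrite exchange // lu.
  rewrite exchange //; case: ifP => // lu [<- <-] lt_key min_key.
  exists (Some (clus g u, u)); split=> //; split=> // u' vu' lu'.
  by apply: (min_key (ID u')); [apply/mem_nbr_ids; exists u' | rewrite exchange // lu'].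
exists p => [v|v]; first by case: (p_ok v).
have [nd_v _ liv_v _ lab_v] := sim v; have [def_q _] := p_ok v.
move=> st1; rewrite /st1.
have -> : nstep (propose_round s.+1) st v = LState (nd (st v))
    (Member (liv (mb (st v))) (lab (mb (st v))) (lev (mb (st v)))
       (fun t => if t == s.+1 then q v else log (mb (st v)) t))
    (rt (st v)) (fun L => omap fst (q v) == Some L) (dec (st v)) (rq (st v)).
  rewrite /net_step /= liv_v nd_v (proj2 (b0_net v)) /q.
  by case: ifP => // lv; case: (lab_v lv) => -> ->.
rewrite def_q; split=> //= r; case: (p v) => [[r' u]|] //=.
by congr nat_of_bool; apply/eqP/eqP => [[/ID_inj ->]|[->]].
Qed.

Lemma decide_run last p st2 r : let g' := resolve K g s.+1 p in
  let g2 := if last then raise B g' else g' in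
  nd (st2 r) = b0 r -> rt (st2 r) = Root (tokens g r) (stalled g r) (level g r) ->
  cnt (st2 r) (ID r) = nprops p r ->
  let x := nstep (decide_round B K last) st2 r in
  rt x = Root (tokens g2 r) (stalled g2 r) (level g2 r) /\
  dec x (ID r) = (nat_of_bool (accepts K g p r), level g2 r).
Proof.
move=> g' g2 nd_r rt_r cnt_r; rewrite /g2 /g' /net_step /= nd_r rt_r (proj1 (b0_net r)) cnt_r.
by case: (last).
Qed.

(** The tree communication uses [joins g'], which already contains the proposals of this step. The
    new edges carry these proposals to the roots, and bring the verdict back to refused proposers
    too. *)
Lemma step_run last st ph j : run_inv e ID B K S g s ph j -> simulates st g ->
  exists2 p, valid_props e ID g p &
  let g' := resolve K g s.+1 p in
  simulates (nrun (step_rounds B K s.+1 last) st) (if last then raise B g' else g').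
Proof.
move=> g_inv sim; have [p p_ok st1_ok] := propose_run g_inv sim.
exists p => // g'; set g2 := if last then _ else _.
have g'_inv := inv_resolve e_sym K_gt0 g_inv p_ok; rewrite -/g' in g'_inv.
have J_tree : join_tree (joins g').
  by move=> t v r u /(inv_joins g'_inv)[/andP[t_gt0 _] _ _ vu ru].
have J_S t v r u : joins g' t v = Some (r, u) -> S r by move/(inv_joins g'_inv)=> [].
have p_memb v r u : p v = Some (r, u) -> memb (joins g') r v s.+1.
  by move=> pv; right; exists s.+1, u; rewrite /= eqxx.
have p_count r : nprops p r < 2 ^ w.
  apply: leq_ltn_trans n_lt; rewrite -[leqRHS]card_ord -sum1_card.
  by apply: leq_sum => v _; case: eqP.
rewrite /step_rounds net_run_cons.
set st1 := nstep _ st in st1_ok *; rewrite net_run_cat.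
have nd1 v : nd (st1 v) = b0 v by case: (st1_ok v).
have log1 : logs (joins g') st1.
  move=> v t; case: (st1_ok v) => _ _ -> _ /=.
  by case: eqP => // _; case: (sim v) => _ _ _ ->.
have sum1 r : \sum_v cnt (st1 v) (ID r) = nprops p r.
  by apply: eq_bigr => v _; case: (st1_ok v) => _ _ _ ->.
have [||||core2 cnt2] := @ups_run (joins g') J_tree s.+1 st1.
- by move=> v; rewrite nd1.
- exact: log1.
- move=> v r; case: (st1_ok v) => _ _ _ ->; case pv: (p v) => [[r' u]|] //=.
  by case: eqP => // -[<-] _; apply: p_memb pv.
- by move=> r; rewrite sum1.
set st2 := nrun _ st1 in core2 cnt2 *.
rewrite net_run_cons net_run_cat; set st3 := nstep _ st2.
have st3_ok r : rt (st3 r) = Root (tokens g2 r) (stalled g2 r) (level g2 r) /\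
  dec (st3 r) (ID r) = (nat_of_bool (accepts K g p r), level g2 r).
  case: (core2 r) => nd2 _ rt2; apply: decide_run; rewrite ?nd2 ?nd1 ?rt2 ?cnt2 ?sum1 //.
  by case: (sim r).
have mb3 v : mb (st3 v) = mb (st1 v) by case: (core2 v).
have nd3 v : nd (st3 v) = b0 v by rewrite -nd1; case: (core2 v).
have log3 : logs (joins g') st3 by move=> v t; rewrite mb3.
have [|core4 dec4] := @downs_run (joins g') J_tree S
    (fun r => (nat_of_bool (accepts K g p r), level g2 r)) s.+1 st3 log3 J_S.
  move=> r _; case: (st3_ok r) => _ ->; split=> //=.
    apply: leq_ltn_trans (leq_ltn_trans (leq_b1 _) _) => //=.
    by apply: leq_ltn_trans n_lt; case: (r) => k /(leq_ltn_trans _)->.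
  apply: leq_ltn_trans B_lt; rewrite /g2; case: (last) => /=; last exact: inv_level g_inv r.
  by case: ifP => _; rewrite ?geq_minl ?(inv_level g_inv).
set st4 := nrun _ st3 in core4 dec4 *; rewrite net_run_cons => v; rewrite /net_run /= /net_step /=.
have [nd4 mb4 rt4] := core4 v; have [nd_v _ liv_v log_v lab_v] := sim v.
have [_ _ mb1 _] := st1_ok v.
have alive2 : alive g2 v = alive g' v by rewrite /g2; case: (last).
have clus2 : clus g2 v = clus g' v by rewrite /g2; case: (last).
have joins2 t : joins g2 t v = joins g' t v by rewrite /g2; case: (last).
have log4 t : log (mb (st4 v)) t = omap idp (joins g' t v) by rewrite mb4 log3.
split=> /=.
- by rewrite nd4; exact: nd3.
- by case: (st3_ok v) => <- _; exact: rt4.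
- rewrite log4 alive2 /= eqxx mb4 mb3 mb1 /= liv_v.
  case pv: (p v) => [[r u]|] /=; last by rewrite andbT.
  rewrite dec4; [by case: accepts | | exact: p_memb pv].
  by apply: (J_S s.+1 v r u); rewrite /= eqxx.
- move=> t; rewrite log4 joins2.
  by case: (omap idp (joins g' s.+1 v)) => [[L i]|] /=; rewrite log4.
rewrite log4 alive2 clus2 /= eqxx mb4 mb3 mb1 /=; case pv: (p v) => [[r u]|] /=.
  move=> _; rewrite dec4; [by [] | | exact: p_memb pv].
  by apply: (J_S s.+1 v r u); rewrite /= eqxx.
rewrite andbT => lv; case: (lab_v lv) => -> _; split=> //; rewrite dec4 //.
  by case: (inv_alive g_inv lv).
case: (inv_alive g_inv lv) => _ _ cv; apply: memb_leq (leqnSn s) _.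
exact: (memb_resolve K p (leqnn s) cv).
Qed.

End Step.

End Network.

(** * One color class, and all of them *)

(** The color is part of the label because a node killed in one class can name a cluster again in a
    later one. *)
Definition code (B c L : nat) := c * 2 ^ B + L.

Lemma code_inj B c c' L L' : L < 2 ^ B -> L' < 2 ^ B ->
  code B c L = code B c' L' -> c = c' /\ L = L'.
Proof.
move=> lt_L lt_L' eq_code.
have := congr1 (modn^~ (2 ^ B)) eq_code; rewrite !modnMDl !modn_small // => eq_L.
have := congr1 (divn^~ (2 ^ B)) eq_code.
by rewrite !divnMDl ?expn_gt0 // !divn_small // !addn0.
Qed.

Section Distance.

Variables (n : nat) (e : rel 'I_n).

Lemma dist_le_trans (u v w : 'I_n) d d' :
  dist_le e u v d -> dist_le e v w d' -> dist_le e u w (d + d').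
Proof.
move=> [p [p_path p_last p_d]] [q [q_path q_last q_d]]; exists (p ++ q).
by rewrite cat_path last_cat size_cat p_path p_last q_path leq_add.
Qed.

Lemma dist_le_sym (u v : 'I_n) d : symmetric e -> dist_le e u v d -> dist_le e v u d.
Proof.
move=> e_sym [p [p_path <- p_d]]; exists (rev (belast u p)).
rewrite rev_path size_rev size_belast; split=> //; last first.
  by case: p {p_path p_d} => //= x p; rewrite rev_cons last_rcons.
by rewrite (eq_path (e' := e)) // => x y; apply: e_sym.
Qed.

(** Every parent was a member strictly before its child joined, so the walk to the root has at most
    [t] edges. *)
Lemma memb_dist (J : joins_t n) r v t : join_tree e J -> memb J r v t -> dist_le e v r t.
Proof.
move=> J_tree; have [k] := ubnP t; elim: k t v => // k IHk t v lt_tk.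
case=> [->|[t' [u [t't Jt]]]]; first by exists [::].
have [t'0 vu ru] := J_tree _ _ _ _ Jt.
have [|p [p_path p_last p_t]] := IHk t'.-1 u _ ru.
  by rewrite prednK // (leq_trans t't).
exists (u :: p); rewrite /= vu p_path p_last; split=> //.
by rewrite (leq_trans _ t't) // -(prednK t'0) ltnS.
Qed.

End Distance.

Lemma lookup_mem s L q : uniq (map fst s) -> (lookup s L == Some q) = ((L, q) \in s).
Proof.
elim: s => //= -[L' q'] s IHs /andP[/= L's /IHs {}IHs]; rewrite inE xpair_eqE.
have [eq_L|ne_L] := eqVneq L' L; last exact: IHs.
rewrite /= (inj_eq Some_inj) eq_sym orbC.
case Lq: (_ \in s) => //; case/negP: L's; rewrite eq_L.
by apply/mapP; exists (L, q).
Qed.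

(** [anc] unfolds at the last parent step, while inductions toward the root peel off the first. *)
Lemma anc_S n (e : rel 'I_n) ID o L k v :
  anc e ID o L k.+1 v = obind (anc e ID o L k) (tparent e ID o L v).
Proof.
elim: k => [|k IHk] /=; first by case: tparent.
by move: IHk => /= ->; case: tparent.
Qed.

Section Entries.

Variables (B m c i : nat) (lg : nat -> option (nat * nat)) (keep : pred nat).

(** The earliest proposal to [L] determines the parent, so that join times decrease toward the root.
    [iota] starts at 0 to make the index found by [find] equal to the step. *)
Definition tree_parent L : option nat :=
  if L == i then None else
  omap snd (lg (find (fun t => omap fst (lg t) == Some L) (iota 0 m.+1))).

Definition tree_labels := undup (i :: pmap (fun t => omap fst (lg t)) (iota 1 m)).

Definition entries := [seq (code B c L, tree_parent L) | L <- tree_labels & keep L].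

End Entries.

(** A cluster may have lost all its live nodes. Tally and verdict detect this, so that trees of
    empty clusters are not output. *)
Definition tally_round : round lstate := Round no_msg (fun x _ =>
  LState (nd x) (mb x) (rt x) (fun L => liv (mb x) && (lab (mb x) == L)) (dec x) (rq x)).

Definition verdict_round : round lstate := Round no_msg (fun x _ =>
  LState (nd x) (mb x) (rt x) (cnt x) (fun=> (nat_of_bool (0 < cnt x (me (nd x))), 0)) (rq x)).

Definition finish_round B m c : round lstate := Round no_msg (fun x _ =>
  let v := nd x in let o := out v in let b := mb x in
  LState (Node (me v) (nbs v) (act v && ~~ liv b)
      (if act v then mkOutput (if liv b then code B c (lab b) else nd_cluster o)
         (if liv b then c else nd_color o)
         (nd_trees o ++ entries B m c (me v) (log b) (fun L => (dec x L).1 == 1))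
       else o))
    b (rt x) (cnt x) (dec x) (rq x)).

Fixpoint steps B K m :=
  if m is s.+1 then steps B K s ++ step_rounds B K s.+1 (K.*2 %| s.+1) else [::].

Definition color_rounds B K m c :=
  start_round :: steps B K m ++
  tally_round :: ups m ++ verdict_round :: downs m ++ [:: finish_round B m c].

Fixpoint colors B K m C :=
  if C is c.+1 then colors B K m c ++ color_rounds B K m c else [::].

Section Correctness.

Variables (n : nat) (e : rel 'I_n) (ID : 'I_n -> nat) (w B K P : nat).
Hypothesis e_sym : symmetric e.
Hypothesis ID_inj : injective ID.
Hypothesis ID_lt : forall v, ID v < 2 ^ B.
Hypothesis B_w : B <= w.
Hypothesis n_lt : n < 2 ^ w.
Hypothesis def_K : K = 2 * (3 * P + 2).
Hypothesis P_ge : 2 * B <= P.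
Hypothesis P_big : n * (3 * P + 2) < 2 ^ (P - 2 * B).
Local Notation nstep := (@net_step lstate n e ID w).
Local Notation nrun := (@net_run lstate n e ID w).
Local Notation m := (P * K.*2).

Let K_gt0 : 0 < K. Proof. by rewrite def_K; lia. Qed.
Let ID_ltw v : ID v < 2 ^ w.
Proof. by apply: leq_trans (ID_lt v) _; rewrite leq_exp2l. Qed.
Let B_ltw : B < 2 ^ w.
Proof. exact: leq_ltn_trans B_w (ltn_expl _ _). Qed.

(** The facts about a finished class that the output depends on. [cv_count] bounds the number of
    trees through a node: its own and one per proposal. *)
Record carved (S : pred 'I_n) (g : clustering n) : Prop := Carved {
  cv_alive : forall v, alive g v -> [/\ S v, S (clus g v) & memb (joins g) (clus g v) v m];
  cv_joins : forall t v r u, joins g t v = Some (r, u) ->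
    [/\ 0 < t <= m, S v, S r, e v u & memb (joins g) r u t.-1];
  cv_clus : forall u v, alive g u -> alive g v -> e u v -> clus g u = clus g v;
  cv_dead : 2 * \sum_v (S v && ~~ alive g v) <= \sum_v S v;
  cv_count : forall v, 1 + njoins g m v <= 3 * P + 2 }.

Record forest (c : nat) (g : clustering n) (v : 'I_n) (tr : seq (nat * option nat)) : Prop :=
  Forest {
  fo_uniq : uniq (map fst tr);
  fo_tree : forall X q, (X, q) \in tr -> exists r, [/\ X = code B c (ID r),
    exists2 w, alive g w & clus g w = r, memb (joins g) r v m
    & if r == v then q = None else exists t u, [/\ q = Some (ID u),
        joins g t v = Some (r, u) & forall t', memb (joins g) r v t' -> t <= t']];
  fo_memb : forall w, alive g w -> memb (joins g) (clus g w) v m ->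
    code B c (ID (clus g w)) \in map fst tr;
  fo_size : size tr <= 3 * P + 2 }.

Record color_spec c (st st' : 'I_n -> lstate) (g : clustering n)
    (tr : 'I_n -> seq (nat * option nat)) : Prop := ColorSpec {
  co_carved : carved (fun v => act (nd (st v))) g;
  co_net : local_net e ID st';
  co_act : forall v, act (nd (st' v)) = act (nd (st v)) && ~~ alive g v;
  co_cluster : forall v, nd_cluster (out (nd (st' v))) =
    if alive g v then code B c (ID (clus g v)) else nd_cluster (out (nd (st v)));
  co_color : forall v, nd_color (out (nd (st' v))) =
    if alive g v then c else nd_color (out (nd (st v)));
  co_trees : forall v, nd_trees (out (nd (st' v))) = nd_trees (out (nd (st v))) ++ tr v;
  co_forest : forall v, if act (nd (st v)) then forest c g v (tr v) else tr v = [::] }.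

Lemma entries_forest c S g v lg keep : carved S g -> S v ->
  (forall t, lg t = omap (idp ID) (joins g t v)) ->
  (forall r, S r -> memb (joins g) r v m ->
     keep (ID r) = [exists w, alive g w && (clus g w == r)]) ->
  forest c g v (entries B m c (ID v) lg keep).
Proof.
move=> g_ok Sv def_lg keepP.
have labelsP L : L \in tree_labels m (ID v) lg ->
    exists r, [/\ S r, L = ID r & memb (joins g) r v m].
  rewrite mem_undup inE => /predU1P[->|]; first by exists v; split=> //; left.
  rewrite mem_pmap => /mapP[t]; rewrite mem_iota def_lg add1n ltnS => /andP[t0 tm].
  case Jt: (joins g t v) => [[r u]|] //= [->]; exists r.
  by have [_ _ Sr _ _] := cv_joins g_ok Jt; split=> //; right; exists t, u.
have memb_label r : memb (joins g) r v m -> ID r \in tree_labels m (ID v) lg.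
  rewrite mem_undup inE => -[->|[t [u [tm Jt]]]]; first by rewrite eqxx.
  apply/orP; right; rewrite mem_pmap; apply/mapP; exists t; last by rewrite def_lg Jt.
  by have [/andP[t0 _] _ _ _ _] := cv_joins g_ok Jt; rewrite mem_iota t0 add1n ltnS.
have entryP X q : (X, q) \in entries B m c (ID v) lg keep -> exists r,
    [/\ X = code B c (ID r), S r, keep (ID r), memb (joins g) r v m
      & q = tree_parent m (ID v) lg (ID r)].
  move=> /mapP[L]; rewrite mem_filter => /andP[kL /labelsP[r [Sr def_L rv]]] [-> ->].
  by exists r; rewrite -def_L.
split.
- rewrite map_inj_in_uniq => [|[X q] [X' q']].
    rewrite map_inj_in_uniq ?filter_uniq ?undup_uniq // => L L'.
    rewrite !mem_filter => /andP[_ /labelsP[r [_ -> _]]] /andP[_ /labelsP[r' [_ -> _]]].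
    by move=> [] /code_inj[].
  move=> /entryP[r [-> _ _ _ ->]] /entryP[r' [-> _ _ _ ->]] /= eq_code.
  by have [_ ->] := code_inj (ID_lt r) (ID_lt r') eq_code.
- move=> X q /entryP[r [-> Sr kr rv ->]]; exists r; split=> //.
    by move: kr; rewrite keepP // => /existsP[u /andP[lu /eqP]]; exists u.
  rewrite /tree_parent (inj_eq ID_inj); case: eqP => // ne_rv.
  set t := find _ _; have t_find t' : t' <= m -> t <= t' \/ ~ exists u, joins g t' v = Some (r, u).
    move=> t'm; case: (leqP t t') => [|lt_t]; [by left | right=> -[u Jt]].
    have := before_find 0 lt_t; rewrite nth_iota ?ltnS // add0n def_lg Jt /=.
    by rewrite eqxx.
  have [t0 [u [t0m Jt0]]] : exists t u, t <= m /\ joins g t v = Some (r, u)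
    by case: rv => [eq_v|[t1 [u1 []]]]; [case: ne_rv | exists t1, u1].
  have [le_t|] := t_find _ t0m; last by case; exists u.
  have : has (fun t => omap fst (lg t) == Some (ID r)) (iota 0 m.+1).
    by apply/hasP; exists t0; rewrite ?mem_iota // def_lg Jt0 /= eqxx.
  move=> /(nth_find 0); rewrite nth_iota ?ltnS ?(leq_trans le_t) // -/t add0n def_lg.
  case Jt: (joins g t v) => [[r' u']|] //= /eqP[/ID_inj eq_r].
  exists t, u'; rewrite -eq_r; split=> // t' [eq_v|[t1 [u1 [t1t' Jt1]]]].
    by case: ne_rv; rewrite eq_v eq_r.
  have [/andP[_ t1m] _ _ _ _] := cv_joins g_ok Jt1.
  have [le_t1|] := t_find _ t1m; first exact: leq_trans t1t'.
  by case; exists u1; rewrite -eq_r.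
- move=> u lu uv; apply/mapP.
  exists (code B c (ID (clus g u)), tree_parent m (ID v) lg (ID (clus g u))) => //.
  have [_ Su _] := cv_alive g_ok lu.
  apply/mapP; exists (ID (clus g u)) => //; rewrite mem_filter memb_label // andbT.
  by rewrite keepP //; apply/existsP; exists u; rewrite lu eqxx.
rewrite size_map size_filter (leq_trans (count_size _ _)) // (leq_trans (size_undup _)) //=.
apply: leq_trans (cv_count g_ok v); rewrite add1n ltnS size_pmap -sum1_count.
rewrite /njoins /index_iota subSS subn0 big_mkcond; apply: leq_sum => t _ /=.
by rewrite def_lg; case: (joins g t v) => [[r u]|].
Qed.

Lemma steps_run b0 st s :
  (forall v, me (b0 v) = ID v /\ nbs (b0 v) = nbr_ids e ID v) ->
  simulates ID b0 st (singletons (fun v => act (b0 v))) ->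
  exists2 g, run_inv e ID B K (fun v => act (b0 v)) g s (s %/ K.*2) (s %% K.*2)
    & simulates ID b0 (nrun (steps B K s) st) g.
Proof.
move=> b0_net sim0; elim: s => [|s [g g_inv sim]] /=.
  by exists (singletons (fun v => act (b0 v))); rewrite // div0n mod0n; apply: inv_singletons.
rewrite net_run_cat; set last := K.*2 %| s.+1.
have [p p_ok sim'] := step_run e_sym ID_inj ID_ltw n_lt K_gt0 B_ltw b0_net last g_inv sim.
exists (if last then raise B (resolve K g s.+1 p) else resolve K g s.+1 p) => //.
exact (inv_step e_sym K_gt0 g_inv p_ok).
Qed.

Lemma run_carved S g : run_inv e ID B K S g m P 0 -> carved S g.
Proof.
move=> g_inv; split.
- exact: inv_alive g_inv.
- exact: inv_joins g_inv.
- move=> u v; exact: (clus_final K_gt0 g_inv ID_inj ID_lt P_ge P_big).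
- exact: (dead_final g_inv def_K).
- exact: (njoins_le g_inv).
Qed.

(** After the last step the two tree procedures run once more, on the complete trees, to tell every
    node which of its trees belong to nonempty clusters. *)
Lemma color_run c st : local_net e ID st ->
  exists g tr, color_spec c st (nrun (color_rounds B K m c) st) g tr.
Proof.
move=> st_net; pose b0 v := nd (st v); pose S v := act (b0 v).
have T_gt0 : 0 < K.*2 by rewrite double_gt0.
rewrite /color_rounds net_run_cons net_run_cat; set st1 := nstep start_round st.
have [|g g_inv sim] := @steps_run b0 st1 m st_net.
  by move=> v; split=> //= _; case: (st_net v) => ->.
rewrite mulnK // modnMl in g_inv; have g_ok := run_carved g_inv.
have J_tree : join_tree e (joins g).
  by move=> t v r u /(cv_joins g_ok)[/andP[t_gt0 _] _ _ vu ru].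
have J_S t v r u : joins g t v = Some (r, u) -> S r by move/(cv_joins g_ok)=> [].
set st2 := nrun _ st1 in sim *; rewrite net_run_cons net_run_cat; set st3 := nstep _ st2.
have core3 v : core (st3 v) = core (st2 v) by [].
pose size_of r := \sum_v (alive g v && (clus g v == r)).
have cnt3 v r : cnt (st3 v) (ID r) = (alive g v && (clus g v == r)).
  rewrite /st3 /net_step /=; have [_ _ -> _ lab_v] := sim v.
  by case lv: (alive g v) => //=; case: (lab_v lv) => -> _; rewrite (inj_eq ID_inj).
have sum3 r : \sum_v cnt (st3 v) (ID r) = size_of r by apply: eq_bigr => v _; rewrite cnt3.
have log3 : logs ID (joins g) st3 by move=> v t; case: (sim v).
have net3 : local_net e ID st3.
  by move=> v; rewrite /st3 /net_step /=; case: (sim v) => -> _ _ _ _; apply: st_net.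
have [||core4 cnt4] := ups_run e_sym ID_inj ID_ltw J_tree (s := m) net3 log3.
- move=> v r; rewrite cnt3; case: andP => // -[lv /eqP <-] _.
  by case: (cv_alive g_ok lv).
- move=> r; rewrite sum3; apply: leq_ltn_trans n_lt; rewrite -[leqRHS]card_ord -sum1_card.
  by apply: leq_sum => v _; apply: leq_b1.
set st4 := nrun _ st3 in core4 cnt4 *; rewrite net_run_cons net_run_cat; set st5 := nstep _ st4.
have core5 v : core (st5 v) = core (st2 v) by rewrite -core3 -core4.
have log5 : logs ID (joins g) st5 by move=> v t; case: (core5 v) => _ -> _; case: (sim v).
pose D r := (nat_of_bool (0 < size_of r), 0).
have [|core6 dec6] := downs_run e_sym ID_inj ID_ltw J_tree m (D := D) log5 J_S.
  move=> r _; rewrite /D /=; split; rewrite ?expn_gt0 //.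
    rewrite /st5 /net_step /=; have [nd_v _ _] := core4 r; rewrite nd_v.
    by rewrite (proj1 (net3 r)) cnt4 sum3.
  apply: leq_ltn_trans (leq_b1 _) _; apply: leq_ltn_trans n_lt.
  by case: (r) => k /(leq_ltn_trans _)->.
set st6 := nrun _ st5 in core6 dec6 *; rewrite /net_run /=.
have nd6 v : nd (st6 v) = b0 v.
  by have [-> _ _] := core6 v; have [-> _ _] := core5 v; case: (sim v).
have mb6 v : mb (st6 v) = mb (st2 v) by have [_ -> _] := core6 v; case: (core5 v).
pose tr v := if act (b0 v) then entries B m c (me (b0 v)) (log (mb (st2 v)))
  (fun L => (dec (st6 v) L).1 == 1) else [::].
exists g, tr; rewrite /net_step /=; split=> // v.
- by rewrite /= nd6; apply: st_net.
- by rewrite /= nd6 mb6; case: (sim v) => _ _ ->.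
- rewrite /= nd6 mb6; have [_ _ liv_v _ lab_v] := sim v.
  case: ifP => Sv; last by case: ifP => // lv; case: (cv_alive g_ok lv); rewrite /= Sv.
  by rewrite /= liv_v; case: ifP => // lv; case: (lab_v lv) => ->.
- rewrite /= nd6 mb6; have [_ _ liv_v _ lab_v] := sim v.
  case: ifP => Sv; last by case: ifP => // lv; case: (cv_alive g_ok lv); rewrite /= Sv.
  by rewrite /= liv_v.
- by rewrite /= nd6 mb6 /tr; case: ifP; rewrite ?cats0.
rewrite /tr -/(b0 v); case: ifP => Sv; last by rewrite Sv.
rewrite Sv (proj1 (st_net v)).
apply: (entries_forest c g_ok Sv); first by case: (sim v).
move=> r Sr rv; rewrite dec6 // /D /=; case: existsP => [[u lu]|no_u].
  by rewrite lt0n /size_of (bigD1 u) //= lu.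
rewrite /size_of big1 // => u _; apply/eqP; rewrite eqb0; apply/negP => lu.
by case: no_u; exists u.
Qed.

(** * All color classes in succession *)

Section Colors.

Variables (C : nat) (st0 : 'I_n -> lstate).
Hypothesis st0_net : local_net e ID st0.
Hypothesis st0_act : forall v, act (nd (st0 v)).
Hypothesis st0_trees : forall v, nd_trees (out (nd (st0 v))) = [::].
Hypothesis n_ltC : n < 2 ^ C.
Local Notation st c := (nrun (colors B K m c) st0).
Local Notation o := (fun v => out (nd (st C v))).

Lemma st_step c : st c.+1 = nrun (color_rounds B K m c) (st c).
Proof. exact: net_run_cat. Qed.

Lemma st_net c : local_net e ID (st c).
Proof.
elim: c => [//|c IHc]; rewrite st_step; have [g [tr cg]] := color_run c IHc.
exact: co_net cg.
Qed.

(** Each class is obtained existentially, so the families [G] and [Tr] are extended one color at a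
    time. *)
Lemma colors_spec : exists G Tr, forall c, c < C -> color_spec c (st c) (st c.+1) (G c) (Tr c).
Proof.
elim: {+}C => [|k [G [Tr GTr]]].
  by exists (fun=> singletons (fun=> true)), (fun _ _ => [::]).
have [g [tr gtr]] := color_run k (st_net k); rewrite -st_step in gtr.
exists (fun c => if c == k then g else G c), (fun c => if c == k then tr else Tr c) => c.
by rewrite ltnS leq_eqVlt; case: eqP => [->|_] //= /GTr.
Qed.

Section Output.

Variables (G : nat -> clustering n) (Tr : nat -> 'I_n -> seq (nat * option nat)).
Hypothesis G_ok : forall c, c < C -> color_spec c (st c) (st c.+1) (G c) (Tr c).

Let carved_of c (lt_c : c < C) := co_carved (G_ok lt_c).

Lemma active_after c v k : c < k <= C -> alive (G c) v -> act (nd (st k v)) = false.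
Proof.
move=> /andP[ck kC] lv; elim: k ck kC => // k IHk; rewrite ltnS leq_eqVlt => ck kC.
rewrite (co_act (G_ok kC)); case/predU1P: ck => [<-|ck]; first by rewrite lv andbF.
by rewrite IHk // ltnW.
Qed.

(** A node clustered in class [c] is inactive afterwards, and later classes involve active nodes
    only. *)
Lemma output_cluster c v : c < C -> alive (G c) v ->
  nd_cluster (o v) = code B c (ID (clus (G c) v)) /\ nd_color (o v) = c.
Proof.
move=> cC lv; suff : forall k, c < k <= C -> nd_cluster (out (nd (st k v))) =
    code B c (ID (clus (G c) v)) /\ nd_color (out (nd (st k v))) = c.
  by apply; rewrite cC leqnn.
elim=> // k IHk /andP[]; rewrite ltnS leq_eqVlt => ck kC.
rewrite (co_cluster (G_ok kC)) (co_color (G_ok kC)).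
case/predU1P: ck => [<-|ck]; first by rewrite lv.
case: ifP => lkv; last by apply: IHk; rewrite ck ltnW.
have [] := cv_alive (carved_of kC) lkv.
by rewrite (@active_after c) // ck ltnW.
Qed.

Lemma active_halved c : c <= C -> (\sum_v act (nd (st c v))) * 2 ^ c <= n.
Proof.
elim: c => [_|c IHc cC].
  rewrite muln1 -[leqRHS]card_ord -sum1_card; apply: leq_sum => v _; exact: leq_b1.
apply: leq_trans (IHc (ltnW cC)); rewrite expnS mulnA leq_mul2r mulnC; apply/orP; right.
apply: leq_trans (cv_dead (carved_of cC)); rewrite leq_mul2l; apply: leq_sum => v _.
by rewrite (co_act (G_ok cC)).
Qed.

(** Fewer than [2 ^ C] nodes, halved [C] times, leave none active, and a node becomes inactive only
    by surviving some class. *)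
Lemma output_ex v : exists2 c, c < C & alive (G c) v.
Proof.
have none : act (nd (st C v)) = false.
  have := leq_ltn_trans (active_halved (leqnn C)) n_ltC.
  rewrite -[ltnRHS]mul1n ltn_pmul2r ?expn_gt0 // ltnS leqn0 sum_nat_eq0.
  by move/forallP/(_ v); rewrite eqb0 => /negbTE.
have : forall k, k <= C -> act (nd (st k v)) \/ exists2 c, c < k & alive (G c) v.
  elim=> [|k IHk] kC; first by left.
  have [av|[c ck lv]] := IHk (ltnW kC); last by right; exists c; rewrite // leqW.
  rewrite (co_act (G_ok kC)) av; case lv: (alive (G k) v); last by left.
  by right; exists k.
by move/(_ _ (leqnn C)); rewrite none => -[].
Qed.

Lemma forest_of c v x : c < C -> x \in Tr c v -> forest c (G c) v (Tr c v).
Proof. by move=> cC; have := co_forest (G_ok cC) v; case: ifP => // _ ->. Qed.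

Lemma trees_mem k v x : k <= C ->
  x \in nd_trees (out (nd (st k v))) -> exists2 c, c < k & x \in Tr c v.
Proof.
elim: k => [|k IHk] kC; first by rewrite st0_trees.
rewrite (co_trees (G_ok kC)) mem_cat => /orP[/(IHk (ltnW kC))[c ck xc]|xk].
  by exists c; rewrite // leqW.
by exists k.
Qed.

Lemma mem_trees k c v x : c < k <= C -> x \in Tr c v ->
  x \in nd_trees (out (nd (st k v))).
Proof.
move=> /andP[ck kC] xc; elim: k ck kC => // k IHk; rewrite ltnS leq_eqVlt => ck kC.
rewrite (co_trees (G_ok kC)) mem_cat; case/predU1P: ck => [<-|ck]; first by rewrite xc orbT.
by rewrite IHk // ltnW.
Qed.

Lemma mem_fst (T T' : eqType) (s : seq (T * T')) x :
  reflect (exists y, (x, y) \in s) (x \in map fst s).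
Proof.
apply: (iffP mapP) => [[[x' y] sxy ->]|[y sxy]]; [by exists y | by exists (x, y)].
Qed.

Lemma tree_code c v X : c < C -> X \in map fst (Tr c v) ->
  exists r, [/\ X = code B c (ID r), exists2 u, alive (G c) u & clus (G c) u = r
    & memb (joins (G c)) r v m].
Proof.
move=> cC /mem_fst[q Xq]; have [r [-> r_al rv _]] := fo_tree (forest_of cC Xq) Xq.
by exists r.
Qed.

Lemma trees_uniq k v : k <= C -> uniq (map fst (nd_trees (out (nd (st k v))))).
Proof.
elim: k => [|k IHk] kC; first by rewrite st0_trees.
rewrite (co_trees (G_ok kC)) map_cat cat_uniq IHk ?(ltnW kC) //=; apply/andP; split.
  apply/hasPn => X /(tree_code kC)[r [-> _ _]]; apply/negP => /mem_fst[q].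
  move=> /(trees_mem (ltnW kC))[c ck Xc].
  have [|r' [eq_code _ _]] := @tree_code c v (code B k (ID r)) (ltn_trans ck kC).
    by apply/mem_fst; exists q.
  by have [eq_k _] := code_inj (ID_lt _) (ID_lt _) eq_code; rewrite eq_k ltnn in ck.
have := co_forest (G_ok kC) v; case: ifP => _; first exact: fo_uniq.
by move->.
Qed.

(** A label determines its color, so only the entries made in class [col] are counted. *)
Lemma trees_count v col : count (fun X => [exists u, (nd_cluster (o u) == X) &&
  (nd_color (o u) == col)]) (map fst (nd_trees (o v))) <= 3 * P + 2.
Proof.
set pr := fun X => _; have pr_code c r : c < C -> pr (code B c (ID r)) -> c = col.
  move=> cC /existsP[u /andP[]]; have [c' c'C lu] := output_ex u.
  have [-> ->] := output_cluster c'C lu.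
  by move=> /eqP/(code_inj (ID_lt _) (ID_lt _))[<- _] /eqP.
suff : forall k, k <= C ->
    count pr (map fst (nd_trees (out (nd (st k v))))) <= (col < k) * (3 * P + 2).
  move/(_ C (leqnn C))/leq_trans; apply.
  by rewrite -[leqRHS]mul1n leq_mul2r leq_b1 orbT.
elim=> [|k IHk] kC; first by rewrite st0_trees.
rewrite (co_trees (G_ok kC)) map_cat count_cat.
have [eq_k|ne_k] := eqVneq col k.
  rewrite eq_k leqnn mul1n in IHk *; have := IHk (ltnW kC); rewrite ltnn leqn0 => /eqP->.
  rewrite (leq_trans (count_size _ _)) // size_map.
  by have := co_forest (G_ok kC) v; case: ifP => _; [apply: fo_size | move->].
have -> : count pr (map fst (Tr k v)) = 0.
  apply/eqP; rewrite -leqn0 leqNgt -has_count; apply/hasPn => X /(tree_code kC)[r [-> _ _]].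
  by apply/negP => /(pr_code _ _ kC) eq_k; rewrite eq_k eqxx in ne_k.
by rewrite addn0 ltnS [col <= k]leq_eqVlt (negPf ne_k); apply: IHk (ltnW kC).
Qed.

(** Two nodes of a cluster are connected through its root, within [m] steps each; the root itself
    may lie outside the cluster, so this bounds the weak diameter. *)
Lemma decomposition_ok : network_decomposition e o C (2 * m).
Proof.
have same u v : nd_cluster (o u) = nd_cluster (o v) -> exists c,
    [/\ c < C, alive (G c) u, alive (G c) v & clus (G c) u = clus (G c) v].
  have [c cC lu] := output_ex u; have [c' c'C lv] := output_ex v.
  have [-> _] := output_cluster cC lu; have [-> _] := output_cluster c'C lv.
  move/(code_inj (ID_lt _) (ID_lt _)) => [eq_c /ID_inj eq_r].
  by exists c; rewrite -eq_c in lv eq_r.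
split.
- by move=> v; have [c cC lv] := output_ex v; have [_ ->] := output_cluster cC lv.
- move=> u v /same[c [cC lu lv _]].
  by have [_ ->] := output_cluster cC lu; have [_ ->] := output_cluster cC lv.
- move=> u v uv; have [c cC lu] := output_ex u; have [c' c'C lv] := output_ex v.
  have [-> ->] := output_cluster cC lu; have [-> ->] := output_cluster c'C lv.
  move=> ne_code eq_c; rewrite -eq_c in lv ne_code; case: ne_code.
  by rewrite (cv_clus (carved_of cC) lu lv uv).
move=> u v /same[c [cC lu lv eq_r]]; rewrite mul2n -addnn.
have J_tree : join_tree e (joins (G c)).
  by move=> t x r y /(cv_joins (carved_of cC))[/andP[t_gt0 _] _ _ xy ry].
have [_ _ ru] := cv_alive (carved_of cC) lu; have [_ _ rv] := cv_alive (carved_of cC) lv.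
apply: dist_le_trans (memb_dist J_tree ru) _; rewrite eq_r.
exact: dist_le_sym (memb_dist J_tree rv).
Qed.

Lemma in_tree_code c u v : c < C -> alive (G c) u -> memb (joins (G c)) (clus (G c) u) v m ->
  in_tree o (code B c (ID (clus (G c) u))) v.
Proof.
move=> cC lu uv; have := co_forest (G_ok cC) v; case: ifP => [_ fo|].
  have /mem_fst[q Xq] := fo_memb fo lu uv; apply/mem_fst; exists q.
  by apply: mem_trees Xq; rewrite cC leqnn.
case: uv => [->|[t [y [_ Jt]]]]; first by have [_ ->] := cv_alive (carved_of cC) lu.
by have [_ ->] := cv_joins (carved_of cC) Jt.
Qed.

Lemma in_treeP X v : in_tree o X v -> exists c r q, [/\ c < C, X = code B c (ID r),
  (X, q) \in nd_trees (o v), exists2 w, alive (G c) w & clus (G c) w = r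
  & memb (joins (G c)) r v m /\ if r == v then q = None else exists t u,
     [/\ q = Some (ID u), joins (G c) t v = Some (r, u)
       & forall t', memb (joins (G c)) r v t' -> t <= t']].
Proof.
move=> /mem_fst[q Xq]; have [c cC Xqc] := trees_mem (leqnn C) Xq.
by have [r [def_X r_al rv q_ok]] := fo_tree (forest_of cC Xqc) Xqc; exists c, r, q.
Qed.

Lemma steiner_ok : steiner_trees e ID o m (3 * P + 2).
Proof.
have tr_uniq v := trees_uniq v (leqnn C).
split; [by move=> v; apply: tr_uniq | split].
- move=> v X /in_treeP[c [r [q [cC -> _ [x lx <-] _]]]]; exists x.
  by case: (output_cluster cC lx).
- move=> v; have [c cC lv] := output_ex v; have [-> _] := output_cluster cC lv.
  by apply: in_tree_code => //; case: (cv_alive (carved_of cC) lv).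
- move=> v X pid /eqP; rewrite lookup_mem // => Xq.
  have [|c [r [q [cC def_X Xq' [x lx def_r] [rv q_ok]]]]] := @in_treeP X v.
    by apply/mem_fst; exists (Some pid).
  have eq_q : q = Some pid.
    by move: Xq Xq'; rewrite -!lookup_mem // => /eqP-> /eqP[].
  move: q_ok; rewrite eq_q; case: eqP => // _ [t [u [[->] Jt _]]].
  have [/andP[t_gt0 tm] _ _ vu ru] := cv_joins (carved_of cC) Jt.
  exists u; split=> //; rewrite def_X -def_r; apply: in_tree_code => //; rewrite def_r.
  by apply: memb_leq ru; rewrite (leq_trans (leq_pred t)).
- move=> X [x]; have [c cC lx] := output_ex x; have [-> _] := output_cluster cC lx.
  move=> def_X; have [_ Sr _] := cv_alive (carved_of cC) lx.
  set r := clus (G c) x in def_X Sr; exists r; split.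
    have [|c' [r' [q [c'C eq_X Xq _ [_ q_ok]]]]] := @in_treeP X r.
      by rewrite -def_X; apply: in_tree_code => //; left.
    rewrite -def_X in eq_X; have [_ /ID_inj eq_r] := code_inj (ID_lt _) (ID_lt _) eq_X.
    by rewrite -eq_r eqxx in q_ok; apply/eqP; rewrite lookup_mem // -q_ok.
  (* Induction on the time of membership: the parent of [v] was a member before the first proposal
     of [v] to this cluster. *)
  have tree_anc k : forall t v, t < k -> t <= m -> memb (joins (G c)) r v t ->
      exists k', k' <= t /\ anc e ID o X k' v = Some r.
    elim: k => // k IHk t v lt_tk tm rv.
    have [eq_rv|ne_rv] := eqVneq r v; first by exists 0; rewrite -eq_rv.
    have [|c' [r' [q [c'C eq_X Xq _ [_ q_ok]]]]] := @in_treeP X v.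
      by rewrite -def_X; apply: in_tree_code => //; apply: memb_leq rv.
    rewrite -def_X in eq_X.
    have [eq_c /ID_inj eq_r] := code_inj (ID_lt _) (ID_lt _) eq_X.
    move: q_ok; rewrite -eq_r -eq_c (negPf ne_rv) => -[t0 [u [def_q Jt min_t]]].
    have [/andP[t0_gt0 t0m] _ _ vu ru] := cv_joins (carved_of cC) Jt.
    have le_t := min_t t rv.
    have [||k' [k't anc_u]] := IHk t0.-1 u _ _ ru.
    + by rewrite prednK // (leq_trans le_t).
    + by rewrite (leq_trans (leq_pred _)).
    exists k'.+1; split; first by rewrite (leq_trans _ le_t) // -(prednK t0_gt0) ltnS.
    rewrite anc_S /tparent.
    have -> : lookup (nd_trees (o v)) X = Some q by apply/eqP; rewrite lookup_mem.
    rewrite def_q; case: pickP => [u' /andP[_ /eqP/ID_inj ->] //|/(_ u)].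
    by rewrite vu eqxx.
  move=> v /in_treeP[c' [r' [q [c'C eq_X _ _ [rv _]]]]]; rewrite -def_X in eq_X.
  have [eq_c /ID_inj eq_r] := code_inj (ID_lt _) (ID_lt _) eq_X.
  by apply: (tree_anc m.+1 m) => //; rewrite eq_r eq_c.
move=> v col; exact: trees_count.
Qed.

End Output.

End Colors.

End Correctness.

(** * Parameters *)

Lemma network_decomposition_leq n (e : rel 'I_n) o C C' D D' : C <= C' -> D <= D' ->
  network_decomposition e o C D -> network_decomposition e o C' D'.
Proof.
move=> CC DD [lt_C same adj diam]; split=> // [v|u v /diam[p [p_path p_last p_D]]].
  exact: leq_trans (lt_C v) CC.
by exists p; rewrite (leq_trans p_D).
Qed.

Lemma steiner_trees_leq n (e : rel 'I_n) ID o R R' K K' : R <= R' -> K <= K' ->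
  steiner_trees e ID o R K -> steiner_trees e ID o R' K'.
Proof.
move=> RR KK [uniq_tr [in_cl own par root_tr cong]]; split=> //; split=> // [L|v col].
  move=> /root_tr[r [r_root r_anc]]; exists r; split=> // v /r_anc[k [kR anc_k]].
  by exists k; rewrite (leq_trans kR).
exact: leq_trans (cong v col) KK.
Qed.

Lemma size_ups s : size (ups s) = s.
Proof. by elim: s => //= s ->. Qed.

Lemma size_downs s : size (downs s) = 2 * s.
Proof. by elim: s => //= s IHs; rewrite size_cat IHs /=; lia. Qed.

Lemma size_step_rounds B K s last : size (step_rounds B K s last) = 3 * s + 3.
Proof. by rewrite /= size_cat /= size_cat size_ups size_downs /=; lia. Qed.

Lemma size_steps B K m : size (steps B K m) <= m * (3 * m + 3).
Proof.
by elim: m => // m IHm; rewrite [steps _ _ _]/= size_cat size_step_rounds; move: IHm; lia.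
Qed.

Lemma size_colors B K m C : size (colors B K m C) <= C * ((m + 1) * (3 * m + 4)).
Proof.
elim: C => // C IHC; rewrite [colors _ _ _ _]/= size_cat mulSn addnC leq_add //.
have := size_steps B K m; rewrite /= size_cat /= size_cat /= size_cat size_ups size_downs /=.
lia.
Qed.

Section Algorithm.

Variable cb : nat.

Definition id_bits N := cb * lg N.
(** With [b] and [l] for [id_bits N] and [lg N], removing [2 b] leaves [l] bits to exceed [n] and
    [6 b + 3 l + 4] bits to dominate [3 * phases N + 2]. *)
Definition phases N := 8 * id_bits N + 4 * lg N + 4.
Definition penalty N := 2 * (3 * phases N + 2).

Definition init_state (N i : nat) (nb : seq nat) := LState
  (Node i nb true (mkOutput 0 0 [::])) (Member true i 0 (fun=> None)) (Root 1 false 0)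
  (fun=> 0) (fun=> (0, 0)) (fun=> None).

Definition decomposition_algorithm : Algorithm :=
  program_algorithm (fun N => id_bits N + lg N)
    (fun N => colors (id_bits N) (penalty N) (phases N * (penalty N).*2) (lg N))
    init_state (fun x => out (nd x)).

Lemma leq_lg n N : n <= N -> lg n <= lg N.
Proof. by move=> nN; rewrite ltnS leq_trunc_log. Qed.

Lemma lg_ltn N : N < 2 ^ lg N.
Proof. exact: trunc_log_ltn. Qed.

Lemma lg_poly n N cN : N <= n ^ cN -> lg N <= cN.+1 * lg n.
Proof.
case: N => [|N]; first by rewrite /lg trunc_log0 muln_gt0.
move=> le_N; suff le_log : trunc_log 2 N.+1 <= cN * lg n.
  by rewrite mulSn; apply: (@leq_add 1 (trunc_log 2 N.+1)).
rewrite -(leq_exp2l (m := 2)) // (leq_trans (trunc_logP _ _)) // (leq_trans le_N) //.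
by rewrite mulnC expnM; case: (cN) => // k; rewrite leq_exp2r // ltnW ?lg_ltn.
Qed.

Lemma phases_big n N : n <= N ->
  n * (3 * phases N + 2) < 2 ^ (phases N - 2 * id_bits N).
Proof.
move=> nN; set b := id_bits N; set l := lg N.
have -> : phases N - 2 * b = l + (6 * b + 3 * l + 4) by rewrite /phases -/b -/l; lia.
(* Used at [r = 6 b + 3 l], where [4 (r + 4)] is [24 b + 12 l + 16], two more than
   [3 * phases N + 2]. *)
have exp_ge r : 4 * (r + 4) <= 2 ^ (r + 4).
  by elim: r => // r IHr; rewrite addSn expnS; lia.
rewrite expnD; apply: leq_trans (_ : n.+1 * (3 * phases N + 2) <= _).
  by rewrite ltn_pmul2r // addn2.
apply: leq_mul; first exact: leq_ltn_trans nN (lg_ltn N).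
by apply: leq_trans (exp_ge _); rewrite /phases -/b -/l; lia.
Qed.

Lemma algorithm_correct n (e : rel 'I_n) (ID : 'I_n -> nat) b N :
  symmetric e -> injective ID -> (forall v, ID v < 2 ^ b) -> b <= cb * lg n -> n <= N ->
  let o := final_output decomposition_algorithm e ID N in
  let m := phases N * (penalty N).*2 in
  network_decomposition e o (lg N) (2 * m) /\ steiner_trees e ID o m (3 * phases N + 2).
Proof.
move=> e_sym ID_inj ID_lt b_le nN o m.
have ID_ltB v : ID v < 2 ^ id_bits N.
  apply: leq_trans (ID_lt v) _; rewrite leq_exp2l // (leq_trans b_le) //.
  by rewrite leq_mul2l leq_lg ?orbT.
have n_lt : n < 2 ^ lg N by apply: leq_ltn_trans nN (lg_ltn N).
have n_ltw : n < 2 ^ (id_bits N + lg N).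
  by apply: leq_trans n_lt _; rewrite leq_exp2l // leq_addl.
have P_ge : 2 * id_bits N <= phases N by rewrite /phases; lia.
have o_def := program_output (fun N => id_bits N + lg N)
  (fun N => colors (id_bits N) (penalty N) (phases N * (penalty N).*2) (lg N))
  init_state (fun x => out (nd x)) e ID N.
pose st0 v := init_state N (ID v) (nbr_ids e ID v).
have st0_net : local_net e ID st0 by [].
have [G [Tr G_ok]] := colors_spec e_sym ID_inj ID_ltB (leq_addr _ _) n_ltw (erefl (penalty N))
  P_ge (phases_big nN) (lg N) st0_net.
have st0_act v : act (nd (st0 v)) by [].
have st0_trees v : nd_trees (out (nd (st0 v))) = [::] by [].
rewrite /o /decomposition_algorithm o_def; split.
  exact: (@decomposition_ok _ _ _ _ _ _ _ e_sym ID_inj ID_ltB _ _ st0_act n_lt _ _ G_ok).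
exact: (@steiner_ok _ _ _ _ _ _ _ ID_inj ID_ltB _ _ st0_act st0_trees n_lt _ _ G_ok).
Qed.

Lemma algorithm_bandwidth n (e : rel 'I_n) (ID : 'I_n -> nat) N :
  bandwidth_ok decomposition_algorithm e ID N (2 * (id_bits N + lg N)).
Proof. exact: program_bandwidth. Qed.

Lemma algorithm_rounds N : al_rounds decomposition_algorithm N
  <= lg N * ((phases N * (penalty N).*2 + 1) * (3 * (phases N * (penalty N).*2) + 4)).
Proof. exact: size_colors. Qed.

End Algorithm.

Theorem theorem2p1 :
  forall cb cN : nat,
  exists c : nat, exists A : Algorithm,
  forall (n : nat) (e : rel 'I_n), symmetric e -> irreflexive e ->
  forall (b : nat) (ID : 'I_n -> nat), injective ID ->
    (forall v, ID v < 2 ^ b) -> b <= cb * lg n ->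
  forall N : nat, n <= N <= n ^ cN ->
    let o := final_output A e ID N in
    [/\ al_rounds A N <= c * lg n ^ 5,
        bandwidth_ok A e ID N (c * lg n),
        network_decomposition e o (c * lg n) (c * lg n ^ 2)
      & steiner_trees e ID o (c * lg n ^ 2) (c * lg n)].
Proof.
(* There are at most [a * lg N] phases and [d * lg N ^ 2] steps per color, and [X] dominates every
   constant that occurs. The factor [cN.+1 ^ 5] turns powers of [lg N] up to the fifth into powers
   of [lg n]. *)
move=> cb cN; pose a := 8 * cb + 8; pose d := a * (6 * a + 4).*2.
pose X := (d + 1) * (3 * d + 4) + 3 * a + 2 * cb + 2 * d + 2.
exists (X * cN.+1 ^ 5), (decomposition_algorithm cb).
move=> n e e_sym _ b ID ID_inj ID_lt b_le N /andP[nN N_le] o.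
set l := lg N; set k := lg n.
have scale i Y : i <= 5 -> Y <= X -> Y * l ^ i <= X * cN.+1 ^ 5 * k ^ i.
  move=> i5 YX; rewrite -mulnA leq_mul //; case: i i5 => [_|i i5].
    by rewrite muln1 expn_gt0.
  apply: leq_trans (_ : (cN.+1 * k) ^ i.+1 <= _); first by rewrite leq_exp2r ?lg_poly.
  by rewrite expnMn leq_mul2r leq_pexp2l ?orbT.
have scale1 Y : Y <= X -> Y * l <= X * cN.+1 ^ 5 * k.
  by move=> YX; have := scale 1 Y isT YX; rewrite !expn1.
have l_gt0 : 0 < l by [].
have P_le : phases cb N <= a * l by rewrite /phases /id_bits -/l /a; lia.
have K_le : penalty cb N <= (6 * a + 4) * l by rewrite /penalty; lia.
have m_le : phases cb N * (penalty cb N).*2 <= d * l ^ 2.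
  apply: leq_trans (leq_mul P_le (_ : _ <= (6 * a + 4).*2 * l)) _.
    by rewrite -doubleMl leq_double.
  by rewrite mulnACA.
have [dec_ok tr_ok] := algorithm_correct e_sym ID_inj ID_lt b_le nN.
split.
- apply: leq_trans (algorithm_rounds cb N) _; set m := phases cb N * _ in m_le *.
  apply: leq_trans (scale 5 ((d + 1) * (3 * d + 4)) _ _) => //; last by rewrite /X; lia.
  have l2_gt0 : 0 < l ^ 2 by rewrite expn_gt0.
  rewrite (expnD _ 1 4) expn1 [leqRHS]mulnCA leq_mul2l; apply/orP; right.
  by rewrite (expnD l 2 2) mulnACA; apply: leq_mul; move: m_le l2_gt0; lia.
- move=> t t_lt v u vu.
  have := algorithm_bandwidth ID t_lt vu; case: (al_send _ _) => // msg msg_le.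
  apply: leq_trans msg_le _; apply: leq_trans (scale1 (2 * cb + 2) _); last by rewrite /X; lia.
  by rewrite /id_bits -/l; lia.
- apply: network_decomposition_leq dec_ok.
    by rewrite -[lg N]mul1n; apply: scale1; rewrite /X; lia.
  apply: leq_trans (scale 2 (2 * d) _ _) => //; last by rewrite /X; lia.
  by rewrite -mulnA leq_mul2l m_le orbT.
apply: steiner_trees_leq tr_ok.
  by apply: leq_trans m_le _; apply: scale; rewrite // /X; lia.
by apply: leq_trans (scale1 (3 * a + 2) _); [lia | rewrite /X; lia].
Qed.
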